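(* The arbitrary-epoch probability vectors are given by $$R(n,0)=\frac{\sum_{j=0}^{n}\gamma^{+}(j)\tilde D^{\,n-j}(-C)^{-1}}{E},\quad 0\le n\le h-1\quad(\text{only for SV, } \epsilon=0),$$ $$\xi(0,h)=\Big((1-\epsilon)R(h-1,0)D+\frac{\xi^{+}(h)+\gamma^{+}(h)-\xi^{+}(0,h)}{E}\Big)(-C)^{-1},$$ $$\xi(0,r)=\Big(\frac{\xi^{+}(r)+\gamma^{+}(r)-\xi^{+}(0,r)}{E}\Big)(-C)^{-1},\quad h+1\le r\le H-1,$$ $$\xi(n,r)=\Big(\xi(n-1,r)D-\frac{\xi^{+}(n,r)}{E}\Big)(-C)^{-1},\quad n\ge1,\ h\le r\le H-1,$$ $$\xi(n,H)=\Big(\xi(n-1,H)D+\frac{\xi^{+}(n+H)+\gamma^{+}(n+H)-\xi^{+}(n,H)}{E}\Big)(-C)^{-1},\quad n\ge0\quad(\text{with }\xi(-1,H)=\mathbf 0),$$ $$\gamma(k,k)=\Big(\frac{\xi^{+}(k)+\epsilon\,\gamma^{+}(k)-\gamma^{+}(k,k)}{E}\Big)(-C)^{-1},\quad 0\le k\le h-1,$$ $$\gamma(n,k)=\Big(\gamma(n-1,k)D-\frac{\gamma^{+}(n,k)}{E}\Big)(-C)^{-1},\quad n\ge k+1,\ 0\le k\le h-1,$$ where $$E=\hat w+(1-\epsilon)\sum_{n=0}^{h-1}\sum_{j=0}^{n}\gamma^{+}(j)\tilde D^{\,n-j}(-C)^{-1}\mathbf e,$$ $$\hat w=s_H\sum_{n=H+1}^{\infty}\big(\xi^{+}(n)+\gamma^{+}(n)\big)\mathbf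 e+\sum_{n=h}^{H}\big(\xi^{+}(n)+\gamma^{+}(n)\big)\mathbf e\,s_n+\sum_{n=0}^{h-1}\big(\xi^{+}(n)\mathbf e\,x_n+(1-\epsilon)\gamma^{+}(n)\mathbf e\,s_h+\epsilon\,\gamma^{+}(n)\mathbf e\,x_n\big).$$
   Context: Model. Single-server queue with infinite buffer. Customers arrive according to a Markovian arrival process (MAP) with $m$ phases and $m\times m$ matrices $C=(c_{i,j})$ (transition rates without arrival; negative diagonal, non-negative off-diagonal, $C$ invertible) and $D=(d_{i,j})\ge 0$ (transition rates with one arrival); $C+D$ is the infinitesimal generator of the underlying phase chain, with stationary probability vector $\bar\xi$ ($\bar\xi(C+D)=\mathbf 0$, $\bar\xi\mathbf e=1$), and $\lambda=\bar\xi D\mathbf e$. Here $\mathbf e$ is the $m\times1$ column of ones. Put $\tilde D=(-C)^{-1}D$. The integers $h$ (minimum) and $H$ (maximum), $1\le h\le H$, are service thresholds. When a service ends and the queue length is $l\ge h$, the server immediately serves a batch of size $\min(l,H)$. A batch of size $r$ ($h\le r\le H$) has generally distributed service time with density $s_r(t)$ and mean $s_r=1/\mu_r$ (the symbol $s_r$ without argument always denotes the mean). If at the end of a service the queue length is $k<h$, the server starts a vacation of type $k$, generally distributed with density $v_k(t)$ and mean $x_k=1/\nu_k$ ($0\le k\le h-1$). If at the end of a vacation the queue length is $l\ge h$, a batch of size $\min(l,H)$ is served. If it is $l<h$: under single vacation (SV, $\epsilon=0$) the server stays dormant until the queue length reaches $h$ and then serves these $h$ customers; under multiple vacation (MV,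 $\epsilon=1$) it starts a new vacation of type $l$. Stability $\lambda s_H/H<1$ holds and the system is in steady state. Steady-state quantities (row vectors over phases $i=1,\dots,m$). $R(n,0)$, $0\le n\le h-1$ (SV only; terms with factor $1-\epsilon$ are absent for MV): probability that the queue length is $n$, the server is dormant and the phase is $i$. $\xi(n,r,u)$, $n\ge0$, $h\le r\le H$: density in $u$ of queue length $n$, a batch of size $r$ in service, phase $i$, remaining service time $u$. $\gamma(n,k,u)$, $0\le k\le h-1$, $n\ge k$: density in $u$ of queue length $n$, vacation of type $k$ in progress, phase $i$, remaining vacation time $u$. The arbitrary-epoch probability vectors are $R(n,0)$, $\xi(n,r)=\int_0^\infty\xi(n,r,u)du$ and $\gamma(n,k)=\int_0^\infty\gamma(n,k,u)du$; total probability is one: $(1-\epsilon)\sum_{n=0}^{h-1}R(n,0)\mathbf e+\sum_{n\ge0}\sum_{r=h}^{H}\xi(n,r)\mathbf e+\sum_{n\ge0}\sum_{k=0}^{\min(n,h-1)}\gamma(n,k)\mathbf e=1$. They satisfy $0=(1-\epsilon)(R(0,0)C+\gamma(0,0,0))$; $0=(1-\epsilon)(R(n,0)C+R(n-1,0)D+\sum_{k=0}^{n}\gamma(n,k,0))$, $1\le n\le h-1$; $-\frac{d}{du}\xi(0,h,u)=\xi(0,h,u)C+(1-\epsilon)R(h-1,0)D\,s_h(u)+(\sum_{k=0}^{h-1}\gamma(h,k,0)+\sum_{j=h}^{H}\xi(h,j,0))s_h(u)$; $-\frac{d}{du}\xi(0,r,u)=\xi(0,r,u)C+(\sum_{k=0}^{h-1}\gamma(r,k,0)+\sum_{j=h}^{H}\xi(r,j,0))s_r(u)$,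 $h+1\le r\le H$; $-\frac{d}{du}\xi(n,r,u)=\xi(n,r,u)C+\xi(n-1,r,u)D$, $h\le r\le H-1$, $n\ge1$; $-\frac{d}{du}\xi(n,H,u)=\xi(n,H,u)C+\xi(n-1,H,u)D+(\sum_{k=0}^{h-1}\gamma(n+H,k,0)+\sum_{j=h}^{H}\xi(n+H,j,0))s_H(u)$, $n\ge1$; $-\frac{d}{du}\gamma(k,k,u)=\gamma(k,k,u)C+(\sum_{r=h}^{H}\xi(k,r,0)+\epsilon\sum_{j=0}^{k}\gamma(k,j,0))v_k(u)$, $0\le k\le h-1$; $-\frac{d}{du}\gamma(n,k,u)=\gamma(n,k,u)C+\gamma(n-1,k,u)D$, $n\ge k+1$, $0\le k\le h-1$. Completion-epoch probabilities. Consider all epochs at which a service ends or a vacation ends, pooled together. In steady state at such epochs, $\xi_i^{+}(n,r)$ is the probability that the epoch is the end of service of a batch of size $r$ with $n$ customers in the queue (before the next service or vacation starts) and phase $i$, and $\gamma_i^{+}(n,k)$ is the probability that it is the end of a vacation of type $k$ with $n$ customers in the queue and phase $i$. Thus $\sum_{n\ge0}\sum_{r=h}^{H}\xi^{+}(n,r)\mathbf e+\sum_{n\ge0}\sum_{k=0}^{\min(n,h-1)}\gamma^{+}(n,k)\mathbf e=1$, with row vectors $\xi^{+}(n,r)=(\xi_i^{+}(n,r))_{i}$, $\gamma^{+}(n,k)=(\gamma_i^{+}(n,k))_{i}$. Put $\xi^{+}(n)=\sum_{r=h}^{H}\xi^{+}(n,r)$ and $\gamma^{+}(n)=\sum_{k=0}^{\min(n,h-1)}\gamma^{+}(n,k)$,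 $n\ge0$.
   Formalization: The formula for ξ(n,H) at n=0 is asserted only for h<H; when h=H the formula for ξ(0,h) applies instead, since under SV the displayed ξ(0,H) formula omits the term R(h−1,0)D and contradicts it. *)

(* Defs.v *)
From HB Require Import structures.
From mathcomp Require Import all_boot all_order all_algebra.
From mathcomp Require Import all_classical all_reals all_analysis.

Set Implicit Arguments.
Unset Strict Implicit.
Unset Printing Implicit Defensive.

Import Order.TTheory GRing.Theory Num.Theory.
Import numFieldNormedType.Exports.

Local Open Scope classical_set_scope.
Local Open Scope ring_scope.


Definition halfline (R : realType) : set R := `[0, +oo[.
Arguments halfline R : clear implicits.

(* x e, where e is the column of ones *)
Definition mass (R : realType) (m : nat) (x : 'rV[R]_m) : R :=
  (x *m (const_mx 1 : 'cV[R]_m)) 0 0.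

Definition vint (R : realType) (m : nat) (A : set R) (F : R -> 'rV[R]_m) :
    'rV[R]_m :=
  \row_i (\int[@lebesgue_measure R]_(u in A) F u 0 i).

Definition is_density (R : realType) (f : R -> R) : Prop :=
  [/\ measurable_fun (halfline R) f,
      (forall t, 0 <= t -> 0 <= f t) &
      (\int[@lebesgue_measure R]_(t in (halfline R)) (f t)%:E = 1)%E].

Definition has_finite_mean (R : realType) (f : R -> R) : Prop :=
  (@lebesgue_measure R).-integrable (halfline R) (fun t => (t * f t)%:E).

Definition mean (R : realType) (f : R -> R) : R :=
  \int[@lebesgue_measure R]_(t in (halfline R)) (t * f t).

Definition locally_ac (R : realType) (F : R -> R) : Prop :=
  exists g : R -> R,
    (forall b, 0 <= b ->
       (@lebesgue_measure R).-integrable `[0, b] (EFin \o g)) /\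
    (forall b, 0 <= b ->
       F b = F 0 + \int[@lebesgue_measure R]_(u in `[0, b]) g u).

(* The equation - (d/du) F (u) = G (u) on the half-line, for general (possibly
   discontinuous) service and vacation densities: F is locally absolutely
   continuous on [0, +oo[, and the equation holds for almost every u. *)
Definition minus_ddu (R : realType) (m : nat) (F G : R -> 'rV[R]_m) : Prop :=
  forall i : 'I_m,
    locally_ac (fun u => F u 0 i) /\
    {ae @lebesgue_measure R, forall u : R, 0 < u ->
       derivable (fun v => F v 0 i) u 1 /\
       - derive1 (fun v => F v 0 i) u = G u 0 i}.

Record queue (R : realType) (m : nat) := Queue {
  qC : 'M[R]_m;
  qD : 'M[R]_m;
  qh : nat;
  qH : nat;
  qs : nat -> R -> R;  (* qs r is the service time density of a batch of size r *)
  qv : nat -> R -> R;  (* qv k is the density of a vacation of type k *)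
  qmv : bool           (* true: multiple vacation; false: single vacation *)
}.

Definition qeps (R : realType) (m : nat) (M : queue R m) : R := (qmv M)%:R.

Definition Dtilde (R : realType) (m : nat) (M : queue R m) : 'M[R]_m :=
  invmx (- qC M) *m qD M.

Definition is_MAP (R : realType) (m : nat) (C D : 'M[R]_m) : Prop :=
  [/\ (forall i, C i i < 0),
      (forall i j, i != j -> 0 <= C i j),
      C \in unitmx,
      (forall i j, 0 <= D i j) &
      (C + D) *m const_mx 1 = 0 :> 'cV[R]_m].

Definition is_stationary_phase (R : realType) (m : nat) (C D : 'M[R]_m)
    (xibar : 'rV[R]_m) : Prop :=
  [/\ (forall i, 0 <= xibar 0 i), xibar *m (C + D) = 0 & mass xibar = 1].

Definition arrival_rate (R : realType) (m : nat) (D : 'M[R]_m)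
    (xibar : 'rV[R]_m) : R := mass (xibar *m D).

Definition is_queue (R : realType) (m : nat) (M : queue R m)
    (xibar : 'rV[R]_m) : Prop :=
  [/\ is_MAP (qC M) (qD M) /\ is_stationary_phase (qC M) (qD M) xibar,
      (1 <= qh M <= qH M)%N,
      (forall r, (qh M <= r <= qH M)%N ->
         is_density (qs M r) /\ has_finite_mean (qs M r)),
      (forall k, (k < qh M)%N ->
         is_density (qv M k) /\ has_finite_mean (qv M k)) &
      arrival_rate (qD M) xibar * mean (qs M (qH M)) / (qH M)%:R < 1].

(* In all that follows, families indexed by (n, r) or (n, k) are meaningful
   only for qh M <= r <= qH M, resp. k < qh M and k <= n. *)

Definition service_marginal (R : realType) (m : nat) (M : queue R m)
    (x : nat -> nat -> 'rV[R]_m) (n : nat) : 'rV[R]_m :=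
  \sum_(qh M <= r < (qH M).+1) x n r.

Definition vacation_marginal (R : realType) (m : nat) (M : queue R m)
    (g : nat -> nat -> 'rV[R]_m) (n : nat) : 'rV[R]_m :=
  \sum_(0 <= k < (minn n (qh M).-1).+1) g n k.

Definition arb (R : realType) (m : nat) (f : nat -> nat -> R -> 'rV[R]_m)
    (n r : nat) : 'rV[R]_m := vint (halfline R) (f n r).

Definition steady_state_densities (R : realType) (m : nat) (M : queue R m)
    (R0 : nat -> 'rV[R]_m) (xi gam : nat -> nat -> R -> 'rV[R]_m) : Prop :=
  [/\ (forall n i, (n < qh M)%N -> 0 <= R0 n 0 i),
      (forall n r i, (qh M <= r <= qH M)%N ->
         (forall u, 0 <= u -> 0 <= xi n r u 0 i) /\
         (@lebesgue_measure R).-integrable (halfline R)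
           (fun u => (xi n r u 0 i)%:E)),
      (forall n k i, (k < qh M)%N -> (k <= n)%N ->
         (forall u, 0 <= u -> 0 <= gam n k u 0 i) /\
         (@lebesgue_measure R).-integrable (halfline R)
           (fun u => (gam n k u 0 i)%:E)) &
      (((1 - qeps M) * \sum_(0 <= n < qh M) mass (R0 n))%:E
       + \sum_(0 <= n <oo) (mass (service_marginal M (arb xi) n))%:E
       + \sum_(0 <= n <oo) (mass (vacation_marginal M (arb gam) n))%:E = 1)%E].

Definition steady_state_equations (R : realType) (m : nat) (M : queue R m)
    (R0 : nat -> 'rV[R]_m) (xi gam : nat -> nat -> R -> 'rV[R]_m) : Prop :=
  let C := qC M in let D := qD M in
  let h := qh M in let H := qH M in let eps := qeps M in
  (0 = (1 - eps) *: (R0 0%N *m C + gam 0%N 0%N 0)) /\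
  (forall n, (1 <= n <= h.-1)%N ->
     0 = (1 - eps) *: (R0 n *m C + R0 n.-1 *m D
                       + \sum_(0 <= k < n.+1) gam n k 0)) /\
  minus_ddu (xi 0%N h) (fun u =>
     xi 0%N h u *m C + ((1 - eps) * qs M h u) *: (R0 h.-1 *m D)
     + qs M h u *: (\sum_(0 <= k < h) gam h k 0
                    + \sum_(h <= j < H.+1) xi h j 0)) /\
  (forall r, (h.+1 <= r <= H)%N ->
     minus_ddu (xi 0%N r) (fun u =>
       xi 0%N r u *m C
       + qs M r u *: (\sum_(0 <= k < h) gam r k 0
                      + \sum_(h <= j < H.+1) xi r j 0))) /\
  (forall n r, (1 <= n)%N -> (h <= r < H)%N ->
     minus_ddu (xi n r) (fun u => xi n r u *m C + xi n.-1 r u *m D)) /\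
  (forall n, (1 <= n)%N ->
     minus_ddu (xi n H) (fun u =>
       xi n H u *m C + xi n.-1 H u *m D
       + qs M H u *: (\sum_(0 <= k < h) gam (n + H)%N k 0
                      + \sum_(h <= j < H.+1) xi (n + H)%N j 0))) /\
  (forall k, (k < h)%N ->
     minus_ddu (gam k k) (fun u =>
       gam k k u *m C
       + qv M k u *: (\sum_(h <= r < H.+1) xi k r 0
                      + eps *: \sum_(0 <= j < k.+1) gam k j 0))) /\
  (forall n k, (k < h)%N -> (k.+1 <= n)%N ->
     minus_ddu (gam n k) (fun u => gam n k u *m C + gam n.-1 k u *m D)).

(* In steady state, the service or vacation in progress at time t ends in
   ]t, t + d] iff its remaining time is at most d.  [ends_within f d n r] is the
   probability vector of this event jointly with queue length n and activity
   r at time t, and [completion_within] is its total probability. *)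
Definition ends_within (R : realType) (m : nat) (f : nat -> nat -> R -> 'rV[R]_m)
    (d : R) (n r : nat) : 'rV[R]_m := vint `[0, d] (f n r).

Definition completion_within (R : realType) (m : nat) (M : queue R m)
    (xi gam : nat -> nat -> R -> 'rV[R]_m) (d : R) : R :=
  fine (\sum_(0 <= n <oo) (mass (service_marginal M (ends_within xi d) n))%:E
        + \sum_(0 <= n <oo) (mass (vacation_marginal M (ends_within gam d) n))%:E)%E.

(* xip and gamp are the steady-state distribution at the pooled completion
   epochs: the law of (queue length, activity ending, phase) given that an
   epoch occurs in ]t, t + d], as d tends to 0. *)
Definition completion_epoch_probabilities (R : realType) (m : nat)
    (M : queue R m) (xi gam : nat -> nat -> R -> 'rV[R]_m)
    (xip gamp : nat -> nat -> 'rV[R]_m) : Prop :=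
  [/\ (forall n r i, (qh M <= r <= qH M)%N ->
         (ends_within xi d n r 0 i / completion_within M xi gam d)
           @[d --> 0^'+] --> xip n r 0 i),
      (forall n k i, (k < qh M)%N -> (k <= n)%N ->
         (ends_within gam d n k 0 i / completion_within M xi gam d)
           @[d --> 0^'+] --> gamp n k 0 i) &
      (\sum_(0 <= n <oo) (mass (service_marginal M xip n))%:E
       + \sum_(0 <= n <oo) (mass (vacation_marginal M gamp n))%:E = 1)%E].

Definition w_hat (R : realType) (m : nat) (M : queue R m)
    (xip gamp : nat -> nat -> 'rV[R]_m) : R :=
  let h := qh M in let H := qH M in let eps := qeps M in
  let xp := service_marginal M xip in
  let gp := vacation_marginal M gamp in
  mean (qs M H) * fine (\sum_(H.+1 <= n <oo) (mass (xp n + gp n))%:E)%E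
  + \sum_(h <= n < H.+1) mass (xp n + gp n) * mean (qs M n)
  + \sum_(0 <= n < h) (mass (xp n) * mean (qv M n)
                       + (1 - eps) * mass (gp n) * mean (qs M h)
                       + eps * mass (gp n) * mean (qv M n)).

Definition E_const (R : realType) (m : nat) (M : queue R m)
    (xip gamp : nat -> nat -> 'rV[R]_m) : R :=
  w_hat M xip gamp
  + (1 - qeps M) * \sum_(0 <= n < qh M) \sum_(0 <= j < n.+1)
      mass (vacation_marginal M gamp j *m Dtilde M ^+ (n - j) *m invmx (- qC M)).

(* Main.v *)
Require Import Defs.
From HB Require Import structures.
From mathcomp Require Import all_boot all_order all_algebra.
From mathcomp Require Import all_classical all_reals all_analysis.
From mathcomp Require Import measurable_realfun ring lra.

Set Implicit Arguments.
Unset Strict Implicit.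
Unset Printing Implicit Defensive.

Import Order.TTheory GRing.Theory Num.Theory.
Import numFieldNormedType.Exports.

Local Open Scope classical_set_scope.
Local Open Scope ring_scope.

(** Consider one type of activity: services of a given size, or vacations of a
    given type. The steady-state equations say that the densities of the
    remaining time form a cascade ([cascade]): mass moves between phases by C,
    to the next queue length by D, and enters through newly started activities.
    Integrating an equation of the cascade over all remaining times
    ([cascade_arbitrary_epoch]) expresses the arbitrary-epoch vector by that of
    the preceding queue length, the start rate, and the density at remaining
    time 0; multiplying by the inverse of - C gives the recursions. The
    equation holds only almost everywhere, so the integration needs Lebesgue's
    differentiation theorem, and the boundary term at infinity vanishes because
    an integrable function has no nonzero limit ([ac_ray_integral]).

    The density at remaining time 0 is the rate of completions with the given
    mark. Conditioning on a completion in a vanishing time interval shows that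
    these rates are c times the completion-epoch probabilities, for a common
    factor c, the total completion rate ([completion_rate]). It is convenient
    that c is never required to be the limit of the total probability over the
    length of the interval, which would need uniformity in the queue length.

    The rate c is found from the total probability 1. Summing a cascade over
    all queue lengths, phase changes cancel since C + D has zero row sums, and
    the summed density at remaining time u is the start rate times the tail of
    the duration beyond u; its integral is the start rate times the mean
    duration ([cascade_total_mass]). With start rates written through
    completion probabilities, and the dormant state solved by a linear
    recursion ([dormant_phases]), the total probability becomes c E = 1
    ([completion_rate_normalization]). Hence E is nonzero and c is its inverse. *)

(** * Absolutely continuous functions on the half-line *)

Lemma measurable_halfline (R : realType) :
  measurable (halfline R : set (measurableTypeR R)).
Proof. exact: measurable_itv. Qed.
#[local] Hint Extern 0 (measurable (halfline _)) => exact: measurable_halfline :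
  core.

Lemma ray_sub_halfline (R : realType) (u : R) : 0 <= u ->
  `[u, +oo[ `<=` halfline R.
Proof. by move=> u0; apply: subset_itvr; rewrite bnd_simp. Qed.

Lemma segment_sub_halfline (R : realType) (u : R) : `[0, u] `<=` halfline R.
Proof. exact: subset_itvl. Qed.

(** Lebesgue differentiation.  Nothing better than almost everywhere can hold,
    since g is determined only through its integrals. *)
Lemma locally_ac_derivative (R : realType) (F g : R -> R) (b : R) :
  (@lebesgue_measure R).-integrable `[0, b] (EFin \o g) ->
  (forall x, 0 <= x <= b ->
     F x = F 0 + \int[@lebesgue_measure R]_(u in `[0, x]) g u) ->
  {ae @lebesgue_measure R, forall u : R, 0 < u < b -> derive1 F u = g u}.
Proof.
move=> intg Fg.
(* [FTC1] is about functions that are locally integrable on the whole line. *)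
pose gb := g \_ `[0, b].
have intgb : (@lebesgue_measure R).-integrable setT (EFin \o gb).
  by rewrite -restrict_EFin; apply/integrable_restrict => //; rewrite setTI.
have := @FTC1 R gb (BLeft 0) _ _.
case=> // [y||N [mN N0 subN]].
- exact: integrableS intgb.
- by apply: integrable_locally.
exists N; split => //; apply: subset_trans subN => u /=.
apply: contra_not => H /andP[u0 ub].
have [|dP eqP] := H; first by rewrite lte_fin.
have -> : g u = gb u by rewrite /gb patchE mem_set//= in_itv/= !ltW.
rewrite -eqP !derive1E.
set P := fun x : R => _ in dP eqP *.
rewrite (@near_eq_derive _ _ _ F (cst (F 0) + P)).
  by rewrite (deriveD (derivable_cst _ _ _) dP) derive_cst add0r.
near=> x.
have x0 : 0 <= x by apply: ltW; near: x; exact: lt_nbhsr.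
have xb : x <= b by apply: ltW; near: x; exact: lt_nbhsl.
rewrite Fg ?x0//; congr (_ + _); apply: eq_Rintegral => y;
  rewrite inE/= in_itv/=.
by case/andP => y0 yx; rewrite /gb patchE mem_set//= in_itv/= y0 (le_trans yx).
Unshelve. all: by end_near. Qed.

(** Turns a differential equation that holds almost everywhere into an
    integral equation that holds at every point. *)
Lemma ac_integral (R : realType) (F G : R -> R) (b : R) :
  locally_ac F ->
  {ae @lebesgue_measure R, forall u : R, 0 < u -> - derive1 F u = G u} ->
  (@lebesgue_measure R).-integrable (halfline R) (EFin \o G) ->
  0 <= b -> F b = F 0 - \int[@lebesgue_measure R]_(u in `[0, b]) G u.
Proof.
move=> [g [intg Fg]] dF intG b0.
rewrite (Fg b b0); congr (_ + _).
have intGb : (@lebesgue_measure R).-integrable `[0, b] (EFin \o G).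
  by apply: integrableS intG => //; exact: segment_sub_halfline.
have openE f : (@lebesgue_measure R).-integrable `[0, b] (EFin \o f) ->
    \int[@lebesgue_measure R]_(u in `[0, b]) f u =
    \int[@lebesgue_measure R]_(u in `]0, b[) f u.
  move=> intf; rewrite -Rintegral_itv_obnd_cbnd; last first.
    by apply: integrableS intf => //; apply: subset_itvr; rewrite bnd_simp.
  rewrite -Rintegral_itv_bndo_bndc//.
  by apply: integrableS intf => //; apply: subset_itv; rewrite bnd_simp.
rewrite !openE//; last exact: intg.
rewrite -[RHS]mulN1r -RintegralZl//; last first.
  by apply: integrableS intGb => //; apply: subset_itv; rewrite bnd_simp.
have msub f : (@lebesgue_measure R).-integrable `[0, b] (EFin \o f) ->
    measurable_fun (`]0, b[%classic : set (measurableTypeR R)) f.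
  move=> /measurable_int/measurable_EFinP; apply: measurable_funS => //.
  by apply: subset_itv; rewrite bnd_simp.
congr fine; apply: ae_eq_integral => //.
- by apply/measurable_EFinP; apply: msub; exact: intg.
- by apply/measurable_EFinP; apply: measurable_funM => //; exact: msub.
have dg := @locally_ac_derivative R F g b (intg b b0)
  (fun x xb => Fg x (proj1 (andP xb))).
apply: (@filterS2 _ _ (ae_filter_ringOfSetsType _)) dg dF => u dg dG /=;
  rewrite in_itv/= => ub.
by rewrite mulN1r -dG ?dg ?opprK//; case/andP: ub.
Qed.

(** Dominated convergence, with the absolute value of f as the bound. *)
Lemma ray_integral_cvg0 (R : realType) (f : R -> R) :
  (@lebesgue_measure R).-integrable (halfline R) (EFin \o f) ->
  (\int[@lebesgue_measure R]_(u in `[n%:R, +oo[) f u) @[n --> \oo] --> 0.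
Proof.
move=> intf.
pose fn (n : nat) := f \_ `[n%:R, +oo[.
have [|||||_ _] := @dominated_convergence _ _ R (@lebesgue_measure R)
  (halfline R) (@measurable_halfline R) (fun n => EFin \o fn n) (cst 0%E)
  (fun x => `|f x|%:E).
- move=> n; apply/measurable_EFinP/measurable_restrict => //.
  apply: measurable_funS ((measurable_EFinP _ _).1 (measurable_int _ intf))
    => //.
- exact: measurable_cst.
- apply: aeW => x _; apply: cvg_near_cst; near=> n.
  rewrite /fn /= patchE memNset// /= in_itv/= andbT; apply/negP; rewrite -ltNge.
  near: n; exact: nbhs_infty_gtr.
- exact: (integrable_norm intf).
- apply: aeW => x n _; rewrite /= /fn patchE lee_fin; case: ifP => // _.
  by rewrite normr0.
- rewrite integral0 => /fine_cvgP[_]; apply: cvg_trans; apply: near_eq_cvg;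
    apply: nearW => n /=.
  transitivity (\int[@lebesgue_measure R]_(x in halfline R) fn n x) => //.
  rewrite /fn -Rintegral_mkcondr setIidr//.
  exact: ray_sub_halfline.
Unshelve. all: by end_near. Qed.

(** An integrable function cannot stay close to a nonzero constant on a ray,
    because the ray has infinite measure. *)
Lemma integrable_limit_eq0 (R : realType) (F : R -> R) (l a : R) :
  (@lebesgue_measure R).-integrable (halfline R) (EFin \o F) ->
  0 <= a -> (forall u, a <= u -> `|F u - l| <= `|l| / 2) -> l = 0.
Proof.
move=> intF a0 Fl; apply/eqP; apply: contraT => l0.
have intFa : (@lebesgue_measure R).-integrable `[a, +oo[ (EFin \o F).
  by apply: integrableS intF => //; exact: ray_sub_halfline.
have /integrableP[mF] := intFa.
rewrite ltNge => /negP[].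
apply: (@le_trans _ _ (\int[@lebesgue_measure R]_(x in `[a, +oo[)
  (`|l| / 2)%:E)%E).
  rewrite integral_cst//= lebesgue_measure_itv/= ltry mulry gtr0_sg ?mul1e//.
  by rewrite divr_gt0// normr_gt0.
apply: ge0_le_integral => //=.
- apply/measurable_EFinP; apply: measurableT_comp => //; exact/measurable_EFinP.
- move=> x /=; rewrite in_itv/= andbT => ax; rewrite lee_fin.
  have := Fl x ax; have := ler_distD (F x) 0 l; rewrite !sub0r !normrN; lra.
Qed.

(** The boundary term at infinity vanishes: F tends to F 0 minus the whole
    integral of G, and an integrable function has no other possible limit than
    zero.  In particular F 0 is the whole integral of G. *)
Lemma ac_ray_integral (R : realType) (F G : R -> R) (u : R) :
  (@lebesgue_measure R).-integrable (halfline R) (EFin \o F) ->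
  locally_ac F ->
  {ae @lebesgue_measure R, forall u : R, 0 < u -> - derive1 F u = G u} ->
  (@lebesgue_measure R).-integrable (halfline R) (EFin \o G) ->
  0 <= u -> F u = \int[@lebesgue_measure R]_(v in `[u, +oo[) G v.
Proof.
move=> intF acF dF intG.
have split_ray (f : R -> R) (b : R) : 0 <= b ->
    (@lebesgue_measure R).-integrable (halfline R) (EFin \o f) ->
    \int[@lebesgue_measure R]_(v in halfline R) f v -
    \int[@lebesgue_measure R]_(v in `[0, b]) f v =
    \int[@lebesgue_measure R]_(v in `[b, +oo[) f v.
  move=> b0 intf; rewrite Rintegral_itvB//.
  rewrite Rintegral_itv_obnd_cbnd//; apply: integrableS intf => //.
  by apply: subset_itvr; rewrite bnd_simp.
pose l := F 0 - \int[@lebesgue_measure R]_(v in halfline R) G v.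
have FE b : 0 <= b -> F b = l + \int[@lebesgue_measure R]_(v in `[b, +oo[) G v.
  by move=> b0; rewrite (ac_integral acF dF intG b0)
    -split_ray// /l addrA subrK.
suff l0 : l = 0 by move=> u0; rewrite FE// l0 add0r.
have [//|l_neq0] := eqVneq l 0.
have := ray_integral_cvg0 (integrable_norm intG).
move=> /cvgrPdist_le/(_ (`|l| / 2));
  rewrite divr_gt0 ?normr_gt0// => /(_ isT)[n _ nP].
apply: (@integrable_limit_eq0 _ F l n%:R) => // b nb.
have b0 : 0 <= b by exact: le_trans nb.
rewrite FE// addrC addKr.
have intGb a : 0 <= a -> (@lebesgue_measure R).-integrable `[a, +oo[
    (EFin \o G).
  by move=> a0; apply: integrableS intG => //; exact: ray_sub_halfline.
apply: le_trans (le_normr_Rintegral _ (intGb _ b0)) _ => //.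
have := nP n (leqnn n); rewrite sub0r normrN ger0_norm; last first.
  by apply: Rintegral_ge0 => x _ /=.
apply: le_trans; apply: fine_le.
- exact: integrable_fin_num (integrable_norm (intGb _ b0)).
- by apply: integrable_fin_num => //; exact: integrable_norm (intGb _ _).
- apply: ge0_subset_integral => //=.
    by case/integrableP: (integrable_norm (intGb n%:R (ler0n _ _))).
  by apply: subset_itvr; rewrite bnd_simp.
Qed.

Lemma locally_ac_right_continuous (R : realType) (F : R -> R) :
  locally_ac F -> F u @[u --> 0^'+] --> F 0.
Proof.
move=> [g [intg Fg]].
rewrite -[X in _ --> X]addr0.
have : F 0 + \int[@lebesgue_measure R]_(x in `[0, u]) g x @[u --> 0^'+]
  --> F 0 + 0.
  apply: cvgD; first exact: cvg_cst.
  apply: cvg_at_right_filter.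
  exact: (parameterized_integral_cvg_left ltr01 (intg 1 ler01)).
apply: cvg_trans; apply: near_eq_cvg; near=> u.
by rewrite -Fg//; apply: ltW; near: u; exact: nbhs_right_gt.
Unshelve. all: by end_near. Qed.

(** This is what makes the value at 0 of a density of the remaining time the
    rate at which the activity ends. *)
Lemma right_average_cvg (R : realType) (F : R -> R) :
  (@lebesgue_measure R).-integrable (halfline R) (EFin \o F) ->
  F u @[u --> 0^'+] --> F 0 ->
  (\int[@lebesgue_measure R]_(u in `[0, d]) F u) / d @[d --> 0^'+] --> F 0.
Proof.
move=> intF Fcvg; apply/cvgrPdist_le => e e0.
move/cvgrPdist_le : Fcvg => /(_ e e0) [r /= r0 rP].
near=> d.
have d0 : 0 < d by near: d; exact: nbhs_right_gt.
have dr : d < r by near: d; exact: nbhs_right_lt.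
have intFd : (@lebesgue_measure R).-integrable `[0, d] (EFin \o F).
  by apply: integrableS intF => //; exact: segment_sub_halfline.
have mud : @lebesgue_measure R `[0, d] = d%:E.
  by rewrite lebesgue_measure_itv/= lte_fin d0 EFinN sube0.
have intc (c : R) : (@lebesgue_measure R).-integrable `[0, d] (EFin \o cst c).
  apply/integrableP; split; first exact/measurable_EFinP.
  by rewrite (integral_cst _ _ `|c|%:E)//= mud -EFinM ltry.
have cE (c : R) : c * d = \int[@lebesgue_measure R]_(u in `[0, d]) c.
  rewrite Rintegral_cst//; congr (_ * _).
  by rewrite [X in fine X](_ : _ = d%:E).
have intB : (@lebesgue_measure R).-integrable `[0, d]
    (EFin \o (fun t => F 0 - F t)).
  exact: (integrableB _ (intc (F 0)) intFd).
rewrite -[X in `|X - _|](mulfK (lt0r_neq0 d0)) -mulrBl normrM.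
rewrite (gtr0_norm (x := d^-1)) ?invr_gt0//.
rewrite ler_pdivrMr// !cE -RintegralB//; last exact: intc.
apply: le_trans (le_normr_Rintegral _ intB) _ => //.
apply: le_Rintegral => //; [exact: integrable_norm intB|exact: intc|].
move=> x /=; rewrite in_itv/= => /andP[x0 xd].
move: x0; rewrite le_eqVlt => /predU1P[<-|x0];
  first by rewrite subrr normr0 ltW.
by apply: rP => //=; rewrite sub0r normrN gtr0_norm// (le_lt_trans xd).
Unshelve. all: by end_near. Qed.

(** * The mean as the integral of the tail *)

(** Tonelli for the function f v on the region 0 <= u <= v: integrating over
    u first gives the factor v. *)
Lemma integral_tail_mean (R : realType) (f : R -> R) :
  measurable_fun (halfline R) f -> (forall t, 0 <= t -> 0 <= f t) ->
  (\int[@lebesgue_measure R]_(u in halfline R)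
     \int[@lebesgue_measure R]_(v in `[u, +oo[) (f v)%:E =
   \int[@lebesgue_measure R]_(t in halfline R) (t * f t)%:E)%E.
Proof.
move=> mf f0.
pose T := measurableTypeR R.
pose A : set (T * T) := [set p | 0 <= p.1 /\ p.1 <= p.2].
pose g : T -> R := f \_ (halfline R).
pose K (p : T * T) : \bar R := (\1_A p * g p.2)%:E.
have g0 v : 0 <= g v.
  rewrite /g patchE; case: ifPn => //; rewrite inE /halfline /= in_itv/= andbT;
    exact: f0.
have mg : measurable_fun setT g by apply/(measurable_restrictT _ _).1.
have mA : measurable A.
  pose c1 (p : T * T) := (0 <= p.1)%R; pose c2 (p : T * T) := (p.1 <= p.2)%R.
  rewrite (_ : A = c1 @^-1` [set true] `&` c2 @^-1` [set true]); last first.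
    by apply/seteqP; split => p /=.
  apply: measurableI.
  - have : measurable_fun setT c1 by exact: measurable_fun_ler.
    by move=> /(_ measurableT [set true]); rewrite setTI; exact.
  - have : measurable_fun setT c2 by exact: measurable_fun_ler.
    by move=> /(_ measurableT [set true]); rewrite setTI; exact.
have mK : measurable_fun setT K.
  apply/measurable_EFinP; apply: measurable_funM; first exact: measurable_indic.
  exact: measurableT_comp.
have K0 p : (0 <= K p)%E by rewrite lee_fin mulr_ge0.
transitivity (\int[@lebesgue_measure R]_u
    \int[@lebesgue_measure R]_v K (u, v))%E.
  rewrite [LHS]integral_mkcond; apply: eq_integral => u _.
  rewrite patchE; case: ifPn => [|]; rewrite /halfline.
    rewrite inE/= in_itv/= andbT => u0.
    rewrite integral_mkcond; apply: eq_integral => v _;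
      rewrite patchE /K indicE.
    case: ifPn.
      rewrite inE/= in_itv/= andbT => uv;
        rewrite mem_set//= mul1r /g patchE mem_set//.
      by rewrite /halfline/= in_itv/= andbT (le_trans u0).
    rewrite notin_setE/= in_itv/= andbT => uv.
    by rewrite memNset ?mul0r// => -[].
  rewrite notin_setE/= in_itv/= andbT => u0.
  rewrite integral0_eq// => v _; rewrite /K indicE memNset ?mul0r// => -[] //.
rewrite fubini_tonelli//.
rewrite [RHS]integral_mkcond; apply: eq_integral => v _.
rewrite patchE; case: ifPn; rewrite /halfline.
  rewrite inE/= in_itv/= andbT => v0.
  rewrite (_ : (fun x => _) = (fun u =>
    (g v)%:E * (\1_(`[0, v]%classic : set T) u)%:E)%E); last first.
    apply/funext => u; rewrite /K !indicE -EFinM mulrC.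
    have -> // : ((u, v) \in A) = (u \in (`[0, v]%classic : set T)).
    by apply/idP/idP; rewrite !inE/= in_itv/= => /andP.
  rewrite ge0_integralZl_EFin//; last first.
    by apply/measurable_EFinP; exact: measurable_indic.
  rewrite integral_indic// setIT /= lebesgue_measure_itv/= lte_fin.
  rewrite /g patchE mem_set; last by rewrite /halfline/= in_itv/= andbT.
  case: ltP => [_|v00]; first by rewrite sube0 -EFinM mulrC.
  have -> : v = 0 by apply/eqP; rewrite eq_le v00.
  by rewrite mul0r mule0.
rewrite notin_setE/= in_itv/= andbT => v0.
rewrite integral0_eq// => u _; rewrite /K /g /= patchE memNset ?mulr0//.
by rewrite /halfline/= in_itv/= andbT.
Qed.

(** * Integrals of row-vector valued functions *)

Lemma integrable_Rintegral_sum (R : realType) (I : Type) (s : seq I)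
    (A : set (measurableTypeR R)) (f : I -> R -> R) :
  measurable A ->
  (forall i, (@lebesgue_measure R).-integrable A (EFin \o f i)) ->
  (@lebesgue_measure R).-integrable A (fun x => (\sum_(i <- s) f i x)%:E) /\
  \int[@lebesgue_measure R]_(x in A) (\sum_(i <- s) f i x) =
  \sum_(i <- s) \int[@lebesgue_measure R]_(x in A) f i x.
Proof.
move=> mA intf; elim: s => [|i s [IH1 IH2]].
  split; first by under eq_fun do rewrite big_nil; exact: integrable0.
  under eq_Rintegral do rewrite big_nil.
  by rewrite big_nil /Rintegral integral0.
split.
  under eq_fun do rewrite big_cons.
  exact: (integrableD mA (intf i) IH1).
under eq_Rintegral do rewrite big_cons.
by rewrite big_cons -IH2 -RintegralD.
Qed.

Definition vintegrable (R : realType) (m : nat) (A : set R)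
    (F : R -> 'rV[R]_m) : Prop :=
  forall i, (@lebesgue_measure R).-integrable A (fun u => (F u 0 i)%:E).

Lemma vintegrable_mulmx (R : realType) (m : nat) (A : set (measurableTypeR R))
    (F : R -> 'rV[R]_m) (C : 'M[R]_m) :
  measurable A -> vintegrable A F ->
  vintegrable A (fun u => F u *m C) /\
  vint A (fun u => F u *m C) = vint A F *m C.
Proof.
move=> mA intF.
have intFC i j : (@lebesgue_measure R).-integrable A (EFin \o (fun u =>
    F u 0 j * C j i)).
  exact: (integrableZr mA (C j i) (intF j)).
split=> [i|].
  by under eq_fun do rewrite mxE;
    exact: (integrable_Rintegral_sum _ mA (intFC i)).1.
apply/rowP => i; rewrite !mxE; under eq_Rintegral do rewrite mxE.
rewrite (integrable_Rintegral_sum _ mA (intFC i)).2; apply: eq_bigr => j _.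
by rewrite mxE RintegralZr//; exact: intF.
Qed.

Lemma vintegrableD (R : realType) (m : nat) (A : set (measurableTypeR R))
    (F G : R -> 'rV[R]_m) :
  measurable A -> vintegrable A F -> vintegrable A G ->
  vintegrable A (fun u => F u + G u) /\
  vint A (fun u => F u + G u) = vint A F + vint A G.
Proof.
move=> mA intF intG; split=> [i|].
  by under eq_fun do rewrite mxE; exact: (integrableD mA (intF i) (intG i)).
apply/rowP => i; rewrite !mxE; under eq_Rintegral do rewrite mxE.
by rewrite RintegralD//; [exact: intF|exact: intG].
Qed.

Lemma vintegrable_scale (R : realType) (m : nat) (A : set (measurableTypeR R))
    (f : R -> R) (v : 'rV[R]_m) :
  measurable A -> (@lebesgue_measure R).-integrable A (EFin \o f) ->
  vintegrable A (fun u => f u *: v) /\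
  vint A (fun u => f u *: v) = (\int[@lebesgue_measure R]_(u in A) f u) *: v.
Proof.
move=> mA intf; split=> [i|].
  by under eq_fun do rewrite mxE; exact: (integrableZr mA (v 0 i) intf).
apply/rowP => i; rewrite !mxE; under eq_Rintegral do rewrite mxE.
by rewrite RintegralZr.
Qed.

Lemma minus_ddu_ray (R : realType) (m : nat) (F G : R -> 'rV[R]_m) (u : R) :
  vintegrable (halfline R) F -> vintegrable (halfline R) G ->
  minus_ddu F G -> 0 <= u -> F u = vint `[u, +oo[ G.
Proof.
move=> intF intG FG u0; apply/rowP => i; rewrite mxE.
have [acF dF] := FG i.
apply: ac_ray_integral acF _ (intG i) u0; first exact: intF.
apply: (@filterS _ _ (ae_filter_ringOfSetsType _)) dF => v dF v0.
exact: (dF v0).2.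
Qed.

Lemma density_integrable (R : realType) (f : R -> R) : is_density f ->
  (@lebesgue_measure R).-integrable (halfline R) (EFin \o f).
Proof.
move=> [mf f0 f1]; apply/integrableP; split; first exact/measurable_EFinP.
have -> : (\int[@lebesgue_measure R]_(x in halfline R) `|(EFin \o f) x| = 1)%E.
  rewrite -f1; apply: eq_integral => t.
  by rewrite /halfline inE/= in_itv/= andbT => t0; rewrite ger0_norm// f0.
exact: ltry.
Qed.

(** * Total mass of a phase vector *)

Lemma massE (R : realType) (m : nat) (x : 'rV[R]_m) : mass x = \sum_i x 0 i.
Proof. by rewrite /mass mxE; apply: eq_bigr => i _; rewrite mxE mulr1. Qed.

Lemma massD (R : realType) (m : nat) (x y : 'rV[R]_m) :
  mass (x + y) = mass x + mass y.
Proof. by rewrite /mass mulmxDl mxE. Qed.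

Lemma massN (R : realType) (m : nat) (x : 'rV[R]_m) : mass (- x) = - mass x.
Proof. by rewrite /mass mulNmx mxE. Qed.

Lemma massZ (R : realType) (m : nat) (a : R) (x : 'rV[R]_m) :
  mass (a *: x) = a * mass x.
Proof. by rewrite /mass -scalemxAl mxE. Qed.

Lemma mass0 (R : realType) (m : nat) : mass (0 : 'rV[R]_m) = 0.
Proof. by rewrite /mass mul0mx mxE. Qed.

Lemma mass_sum (R : realType) (m : nat) (I : Type) (s : seq I) (P : pred I)
    (F : I -> 'rV[R]_m) :
  mass (\sum_(i <- s | P i) F i) = \sum_(i <- s | P i) mass (F i).
Proof. by rewrite /mass mulmx_suml summxE. Qed.

Lemma mass_ge0 (R : realType) (m : nat) (x : 'rV[R]_m) :
  (forall i, 0 <= x 0 i) -> 0 <= mass x.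
Proof. by move=> x0; rewrite massE sumr_ge0. Qed.

(** The rows of C + D sum to zero: a transition without arrival loses as much
    mass as the arrivals carry over. *)
Lemma generator_mass (R : realType) (m : nat) (C D : 'M[R]_m) (x : 'rV[R]_m) :
  is_MAP C D -> mass (x *m C) = - mass (x *m D).
Proof.
move=> [_ _ _ _ CD]; apply/eqP; rewrite -addr_eq0 -massD -mulmxDr /mass.
by rewrite -mulmxA CD mulmx0 mxE.
Qed.

(** The sum of all the entries of D is a crude bound on its row sums; only the
    existence of some constant matters below. *)
Lemma mass_mulmx_le (R : realType) (m : nat) (D : 'M[R]_m) (x : 'rV[R]_m) :
  (forall i j, 0 <= D i j) -> (forall i, 0 <= x 0 i) ->
  0 <= mass (x *m D) <= mass x * \sum_i \sum_j D i j.
Proof.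
move=> D0 x0; apply/andP; split.
  by apply: mass_ge0 => j; rewrite mxE sumr_ge0// => i _; rewrite mulr_ge0.
rewrite !massE; under eq_bigr do rewrite mxE.
rewrite exchange_big mulr_suml /=; apply: ler_sum => i _.
rewrite -mulr_sumr ler_wpM2l// [leRHS](bigD1 i)//= lerDl sumr_ge0// => k _.
by rewrite sumr_ge0.
Qed.

(** * Queue growth during one type of activity *)

(** All services with a given batch size, and all vacations of a given type,
    follow the same scheme.  Level n counts the customers present beyond the
    smallest possible number; the density of the remaining time u evolves by
    phase changes (C), by arrivals from level n - 1 (D) and by new activities,
    which start at level n at rate B n with duration density f. *)
Definition cascade (R : realType) (m : nat) (C D : 'M[R]_m) (f : R -> R)
    (B : nat -> 'rV[R]_m) (y : nat -> R -> 'rV[R]_m) : Prop :=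
  [/\ forall n u i, 0 <= u -> 0 <= y n u 0 i,
      forall n, vintegrable (halfline R) (y n) &
      forall n, minus_ddu (y n) (fun u =>
        y n u *m C + (if n is p.+1 then y p u else 0) *m D + f u *: B n)].

(** The equation of level n integrated over the remaining times beyond u. *)
Lemma cascade_ray (R : realType) (m : nat) (C D : 'M[R]_m) (f : R -> R)
    (B : nat -> 'rV[R]_m) (y : nat -> R -> 'rV[R]_m) (n : nat) (u : R) :
  is_density f -> cascade C D f B y -> 0 <= u ->
  y n u = vint `[u, +oo[ (y n) *m C
          + (if n is p.+1 then vint `[u, +oo[ (y p) else 0) *m D
          + (\int[@lebesgue_measure R]_(v in `[u, +oo[) f v) *: B n.
Proof.
move=> df [_ inty eqy] u0.
pose z v := if n is p.+1 then y p v else 0.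
have intz : vintegrable (halfline R) z.
  rewrite /z; case: (n) => [|p]; last exact: inty.
  by move=> i; under eq_fun do rewrite mxE; exact: integrable0.
have vintz (A : set R) : vint A z = if n is p.+1 then vint A (y p) else 0.
  rewrite /z; case: (n) => [|p] //; apply/rowP => i; rewrite !mxE.
  by rewrite /Rintegral integral0.
have [intC _] := vintegrable_mulmx C (@measurable_halfline R) (inty n).
have [intD _] := vintegrable_mulmx D (@measurable_halfline R) intz.
have [intB _] := vintegrable_scale (B n) (@measurable_halfline R)
  (density_integrable df).
have [intCD _] := vintegrableD (@measurable_halfline R) intC intD.
have [intG _] := vintegrableD (@measurable_halfline R) intCD intB.
have ray (F : R -> 'rV[R]_m) : vintegrable (halfline R) F ->
    vintegrable `[u, +oo[ F.
  by move=> intF i; apply: integrableS (intF i) => //; exact: ray_sub_halfline.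
have mray : measurable (`[u, +oo[%classic : set (measurableTypeR R)) by [].
rewrite {1}(minus_ddu_ray (inty n) intG (eqy n) u0).
rewrite (vintegrableD mray (ray _ intCD) (ray _ intB)).2.
rewrite (vintegrableD mray (ray _ intC) (ray _ intD)).2.
rewrite (vintegrable_mulmx C mray (ray _ (inty n))).2.
rewrite (vintegrable_mulmx D mray (ray _ intz)).2 vintz.
rewrite (vintegrable_scale _ mray _).2//.
apply: integrableS (density_integrable df) => //; exact: ray_sub_halfline.
Qed.

(** Summing the levels 0, ..., n telescopes: the arrivals out of a level are
    the arrivals into the next one, and only the outflow from level n is left. *)
Lemma cascade_partial_mass (R : realType) (m : nat) (C D : 'M[R]_m) (f : R -> R)
    (B : nat -> 'rV[R]_m) (y : nat -> R -> 'rV[R]_m) (n : nat) (u : R) :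
  is_MAP C D -> is_density f -> cascade C D f B y -> 0 <= u ->
  \sum_(0 <= k < n.+1) mass (y k u) =
  (\int[@lebesgue_measure R]_(v in `[u, +oo[) f v) *
    \sum_(0 <= k < n.+1) mass (B k)
  - mass (vint `[u, +oo[ (y n) *m D).
Proof.
move=> hMAP df cy u0; elim: n => [|n IH].
  rewrite !big_nat1 (cascade_ray 0 df cy u0) mul0mx addr0 massD massZ.
  by rewrite (generator_mass _ hMAP) addrC.
rewrite big_nat_recr//= IH (cascade_ray n.+1 df cy u0) !massD massZ.
rewrite (generator_mass _ hMAP) [X in _ = _ * X - _]big_nat_recr//= mulrDr.
ring.
Qed.

(** Bridge between extended real series, in which total probabilities are
    given, and limits of real partial sums, in which the computations are made. *)
Lemma nneseries_EFin (R : realType) (a : nat -> R) (l : R) (N : nat) :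
  (forall n, 0 <= a n) ->
  (\sum_(N <= n <oo) (a n)%:E = l%:E)%E <->
  (\sum_(N <= k < n) a k) @[n --> \oo] --> l.
Proof.
move=> a0; split=> [al|al].
  have := @is_cvg_nneseries R (fun n => (a n)%:E) xpredT N (fun n _ _ => a0 n).
  move/cvg_ex => [l' al']; have ll' : l' = l%:E
    by rewrite -al; apply/esym/cvg_lim.
  move: al'; rewrite ll'; under eq_fun do rewrite sumEFin.
  by move/fine_cvgP => [].
apply/cvg_lim => //; under eq_fun do rewrite sumEFin.
by apply: cvg_EFin => //; exact: nearW.
Qed.

Lemma mass_vint (R : realType) (m : nat) (A : set (measurableTypeR R))
    (F : R -> 'rV[R]_m) :
  measurable A -> vintegrable A F ->
  (@lebesgue_measure R).-integrable A (fun u => (mass (F u))%:E) /\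
  mass (vint A F) = \int[@lebesgue_measure R]_(u in A) mass (F u).
Proof.
move=> mA intF.
have [int1 int2] := integrable_Rintegral_sum (index_enum 'I_m) mA intF.
split; first by under eq_fun do rewrite massE.
rewrite massE; under [RHS]eq_Rintegral do rewrite massE.
by rewrite int2; apply: eq_bigr => i _; rewrite mxE.
Qed.

Lemma vint_ge0 (R : realType) (m : nat) (A : set R)
    (F : R -> 'rV[R]_m) (i : 'I_m) :
  (forall u, A u -> 0 <= F u 0 i) -> 0 <= vint A F 0 i.
Proof. by move=> F0; rewrite mxE; apply: Rintegral_ge0. Qed.

(** The outflow from level n is dominated by the mass of level n, the general
    term of a convergent series. *)
Lemma cascade_outflow_cvg0 (R : realType) (m : nat) (C D : 'M[R]_m) (f : R -> R)
    (B : nat -> 'rV[R]_m) (y : nat -> R -> 'rV[R]_m) (u : R) (l : R) :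
  is_MAP C D -> cascade C D f B y -> 0 <= u ->
  (\sum_(0 <= k < n) mass (vint (halfline R) (y k))) @[n --> \oo] --> l ->
  mass (vint `[u, +oo[ (y n) *m D) @[n --> \oo] --> 0.
Proof.
move=> [_ _ _ D0 _] [y0 inty _] u0 ycvg.
have y0ray n i : 0 <= vint `[u, +oo[ (y n) 0 i.
  by apply: vint_ge0 => v /=; rewrite in_itv/= andbT => uv;
    rewrite y0// (le_trans u0).
set K := \sum_i \sum_j D i j.
have K0 : 0 <= K by rewrite sumr_ge0// => i _; rewrite sumr_ge0.
have bound : mass (vint (halfline R) (y n)) * K @[n --> \oo] --> 0.
  rewrite -[X in _ --> X](mul0r K); apply: cvgM (cvg_cst K).
  by apply: cvg_series_cvg_0; apply/cvg_ex; exists l.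
apply: squeeze_cvgr (cvg_cst 0) bound; apply: nearW => n.
have /andP[-> /le_trans] := mass_mulmx_le D0 (y0ray n); apply.
rewrite ler_wpM2r// !massE; apply: ler_sum => i _; rewrite !mxE.
apply: fine_le.
- apply: integrable_fin_num => //; apply: integrableS (inty n i) => //.
  exact: ray_sub_halfline.
- exact: integrable_fin_num (inty n i).
- apply: ge0_subset_integral => //; last exact: ray_sub_halfline.
    exact: measurable_int (inty n i).
  by move=> v; rewrite /halfline/= in_itv/= andbT => v0; rewrite lee_fin y0.
Qed.

(** Little's law for one type of activity: the probability that it is in
    progress is its start rate times its mean duration.  By
    [cascade_partial_mass] and [cascade_outflow_cvg0], the mass of all levels at
    remaining time u is b times the tail of f beyond u; it remains to integrate
    over u.  The limit in n is taken before integrating, by monotone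
    convergence, because the outflow term need not be integrable in u. *)
Lemma cascade_total_mass (R : realType) (m : nat) (C D : 'M[R]_m) (f : R -> R)
    (B : nat -> 'rV[R]_m) (y : nat -> R -> 'rV[R]_m) (l b : R) :
  is_MAP C D -> is_density f -> has_finite_mean f -> cascade C D f B y ->
  (\sum_(0 <= k < n) mass (vint (halfline R) (y k))) @[n --> \oo] --> l ->
  (\sum_(0 <= k < n) mass (B k)) @[n --> \oo] --> b ->
  l = b * mean f.
Proof.
move=> hMAP df mf cy ycvg Bcvg; have [y0 inty _] := cy.
have [msf f0 f1] := df.
have intf := density_integrable df.
pose tail u := \int[@lebesgue_measure R]_(v in `[u, +oo[) f v.
have ymass0 k (u : R) : 0 <= u -> 0 <= mass (y k u)
  by move=> u0; apply: mass_ge0 => i; exact: y0.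
have ptcvg (u : R) : 0 <= u -> (\sum_(0 <= k < n) mass (y k u)) @[n --> \oo]
  --> b * tail u.
  move=> u0; rewrite -cvg_shiftS -[b * _]subr0.
  have Bcvg1 := Bcvg; rewrite -cvg_shiftS in Bcvg1.
  have L : (\sum_(0 <= k < n.+1) mass (B k)) * tail u
      - mass (vint `[u, +oo[ (y n) *m D) @[n --> \oo] --> b * tail u - 0.
    apply: cvgB; last exact: (cascade_outflow_cvg0 hMAP cy u0 ycvg).
    exact: cvgM Bcvg1 (cvg_cst (tail u)).
  apply: cvg_trans L; apply: near_eq_cvg; apply: nearW => n /=.
  by rewrite (cascade_partial_mass _ hMAP df cy u0) mulrC.
(* At u = 0 the tail is 1, so b is a limit of sums of masses. *)
have tail0 : tail 0 = 1 by rewrite /tail /Rintegral f1.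
have b0 : 0 <= b.
  rewrite -[b]mulr1 -tail0; apply: cvgr_to_ge (ptcvg 0 (lexx 0)) _.
  by apply: nearW => n; rewrite sumr_ge0// => k _; exact: ymass0.
have Ymass0 k : 0 <= mass (vint (halfline R) (y k)).
  apply: mass_ge0 => i; apply: vint_ge0 => u.
  by rewrite /halfline/= in_itv/= andbT; exact: y0.
have lE := (nneseries_EFin l 0 Ymass0).2 ycvg.
apply/EFin_inj; rewrite -lE.
have massint k := mass_vint (@measurable_halfline R) (inty k).
transitivity (\int[@lebesgue_measure R]_(u in halfline R)
    \sum_(0 <= k <oo) (mass (y k u))%:E)%E.
  rewrite integral_nneseries//.
  - apply: eq_eseriesr => k _; rewrite (massint k).2 /Rintegral fineK//.
    exact: integrable_fin_num (massint k).1.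
  - by move=> k; exact: measurable_int (massint k).1.
  - by move=> k u; rewrite /halfline/= in_itv/= andbT => u0;
      rewrite lee_fin ymass0.
(* With b inside the inner integral, [integral_tail_mean] applies to b * f and
   the measurability of the tail as a function of u is never needed. *)
transitivity (\int[@lebesgue_measure R]_(u in halfline R)
    \int[@lebesgue_measure R]_(v in `[u, +oo[) (b * f v)%:E)%E.
  apply: eq_integral => u; rewrite /halfline inE/= in_itv/= andbT => u0.
  rewrite ((nneseries_EFin (b * tail u) 0 (fun k => ymass0 k u u0)).2 (ptcvg u
    u0)).
  have intfu : (@lebesgue_measure R).-integrable `[u, +oo[ (EFin \o f).
    by apply: integrableS intf => //; exact: ray_sub_halfline.
  rewrite /tail -RintegralZl// /Rintegral fineK//.
  exact: (integrable_fin_num _ (integrableZl _ b intfu)).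
rewrite integral_tail_mean.
- under eq_integral do rewrite mulrCA EFinM.
  by rewrite integralZl// EFinM /mean /Rintegral fineK//;
    exact: integrable_fin_num.
- exact: measurable_funM.
- by move=> t t0; rewrite mulr_ge0// f0.
Qed.

(** * Services and vacations as cascades *)

(** The density at remaining time 0 is the rate at which activities end. *)
Definition at_end (R : realType) (m : nat) (f : nat -> nat -> R -> 'rV[R]_m)
  (n r : nat) : 'rV[R]_m := f n r 0.

Definition completions (R : realType) (m : nat) (M : queue R m)
    (xi gam : nat -> nat -> R -> 'rV[R]_m) (n : nat) : 'rV[R]_m :=
  service_marginal M (at_end xi) n + vacation_marginal M (at_end gam) n.

(** A service of size r starts with r customers taken away, hence from a
    completion that leaves n + r customers; n = 0 unless r is the maximum.  In
    addition the dormant server starts a batch of size h at the arrival of the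
    h-th customer. *)
Definition service_starts (R : realType) (m : nat) (M : queue R m)
    (R0 : nat -> 'rV[R]_m) (xi gam : nat -> nat -> R -> 'rV[R]_m) (r n : nat) :
    'rV[R]_m :=
  if (n == 0)%N || (r == qH M) then
    (if (n == 0)%N && (r == qh M) then (1 - qeps M) *: (R0 (qh M).-1 *m qD M)
      else 0)
    + completions M xi gam (n + r)
  else 0.

(** Vacations of type k are indexed by the number n of arrivals since their
    start, so they always start at n = 0; after another vacation they do so only
    under multiple vacations. *)
Definition vacation_starts (R : realType) (m : nat) (M : queue R m)
    (xi gam : nat -> nat -> R -> 'rV[R]_m) (k n : nat) : 'rV[R]_m :=
  if n == 0%N then
    service_marginal M (at_end xi) k + qeps M *:
      vacation_marginal M (at_end gam) k
  else 0.

Lemma vacation_marginal_ge (R : realType) (m : nat) (M : queue R m)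
    (g : nat -> nat -> 'rV[R]_m) (n : nat) : (0 < qh M <= n)%N ->
  vacation_marginal M g n = \sum_(0 <= k < qh M) g n k.
Proof.
move=> /andP[h0 hn]; rewrite /vacation_marginal (minn_idPr _) ?prednK//.
by rewrite (leq_trans _ hn)// leq_pred.
Qed.

Lemma vacation_marginal_lt (R : realType) (m : nat) (M : queue R m)
    (g : nat -> nat -> 'rV[R]_m) (n : nat) : (n < qh M)%N ->
  vacation_marginal M g n = \sum_(0 <= k < n.+1) g n k.
Proof.
move=> nh; rewrite /vacation_marginal (minn_idPl _)//.
by rewrite -ltnS prednK// (leq_ltn_trans _ nh).
Qed.

Lemma service_cascade (R : realType) (m : nat) (M : queue R m)
    (xibar : 'rV[R]_m) (R0 : nat -> 'rV[R]_m)
    (xi gam : nat -> nat -> R -> 'rV[R]_m) (r : nat) :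
  is_queue M xibar -> steady_state_densities M R0 xi gam ->
  steady_state_equations M R0 xi gam -> (qh M <= r <= qH M)%N ->
  cascade (qC M) (qD M) (qs M r) (service_starts M R0 xi gam r)
    (fun n => xi n r).
Proof.
move=> [_ /andP[h0 hH] _ _ _] [_ xidens _ _].
move=> [_ [_ [eq0h [eq0r [eqnr [eqnH _]]]]]] hrH; have /andP[hr rH] := hrH.
have completionsE n : (qh M <= n)%N ->
    completions M xi gam n =
    \sum_(0 <= k < qh M) gam n k 0 + \sum_(qh M <= j < (qH M).+1) xi n j 0.
  by move=> hn; rewrite /completions vacation_marginal_ge ?h0// addrC.
split.
- by move=> n u i u0; exact: (xidens n r i hrH).1.
- by move=> n i; exact: (xidens n r i hrH).2.
move=> [|n]; rewrite /service_starts /=.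
- rewrite add0n completionsE//.
  case: (eqVneq r (qh M)) => [->|rh].
    rewrite [X in minus_ddu _ X](_ : _ = fun u : R =>
      xi 0%N (qh M) u *m qC M + ((1 - qeps M) * qs M (qh M) u) *:
        (R0 (qh M).-1 *m qD M)
      + qs M (qh M) u *: (\sum_(0 <= k < qh M) gam (qh M) k 0
      + \sum_(qh M <= j < (qH M).+1) xi (qh M) j 0))//.
    by apply/funext => u; rewrite mul0mx addr0 scalerDr scalerA addrA mulrC.
  rewrite [X in minus_ddu _ X](_ : _ = fun u : R => xi 0%N r u *m qC M
      + qs M r u *: (\sum_(0 <= k < qh M) gam r k 0
      + \sum_(qh M <= j < (qH M).+1) xi r j 0)).
    by apply: eq0r; rewrite rH andbT ltn_neqAle eq_sym rh.
  by apply/funext => u; rewrite mul0mx addr0 add0r.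
- case: (eqVneq r (qH M)) => [->|rH'].
    rewrite completionsE; last by rewrite (leq_trans hH)// leq_addl.
    by rewrite add0r; exact: (eqnH n.+1).
  rewrite [X in minus_ddu _ X](_ : _ = fun u : R =>
      xi n.+1 r u *m qC M + xi n r u *m qD M).
    by apply: (eqnr n.+1 r) => //; rewrite hr ltn_neqAle rH'.
  by apply/funext => u; rewrite scaler0 addr0.
Qed.

Lemma vacation_cascade (R : realType) (m : nat) (M : queue R m)
    (R0 : nat -> 'rV[R]_m) (xi gam : nat -> nat -> R -> 'rV[R]_m) (k : nat) :
  steady_state_densities M R0 xi gam ->
  steady_state_equations M R0 xi gam -> (k < qh M)%N ->
  cascade (qC M) (qD M) (qv M k) (vacation_starts M xi gam k)
    (fun n => gam (n + k)%N k).
Proof.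
move=> [_ _ gamdens _].
move=> [_ [_ [_ [_ [_ [_ [eqkk eqnk]]]]]]] kh.
split.
- by move=> n u i u0; exact: (gamdens (n + k)%N k i kh (leq_addl _ _)).1.
- by move=> n i; exact: (gamdens (n + k)%N k i kh (leq_addl _ _)).2.
move=> [|n]; rewrite /vacation_starts /=.
- rewrite add0n vacation_marginal_lt//.
  rewrite [X in minus_ddu _ X](_ : _ = fun u : R => gam k k u *m qC M
      + qv M k u *: (\sum_(qh M <= r < (qH M).+1) xi k r 0
                     + qeps M *: \sum_(0 <= j < k.+1) gam k j 0));
                       first exact: eqkk.
  by apply/funext => u; rewrite mul0mx addr0.
- rewrite [X in minus_ddu _ X](_ : _ = fun u : R => gam (n.+1 + k)%N k u *m qC M
      + gam (n.+1 + k)%N.-1 k u *m qD M).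
    by apply: eqnk => //; rewrite addSn ltnS leq_addl.
  by apply/funext => u; rewrite scaler0 addr0.
Qed.

(** * Proportionality of end densities and epoch probabilities *)

Lemma cascade_end_rate (R : realType) (m : nat) (C D : 'M[R]_m) (f : R -> R)
    (B : nat -> 'rV[R]_m) (y : nat -> R -> 'rV[R]_m) (n : nat) (i : 'I_m) :
  cascade C D f B y -> (vint `[0, d] (y n)) 0 i / d @[d --> 0^'+] --> y n 0 0 i.
Proof.
move=> [_ inty eqy]; under eq_fun do rewrite mxE.
apply: right_average_cvg; first exact: inty.
apply: locally_ac_right_continuous; exact: (eqy n i).1.
Qed.

(** Both products have the common value a b / (w s), so no quotient of
    limits has to be taken and w may vanish. *)
Lemma cross_ratio_limits (R : realType) (a b w s : R -> R) (p q x z : R)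
    (F : set_system R) {FF : ProperFilter F} :
  a d / w d @[d --> F] --> p -> a d / s d @[d --> F] --> x ->
  b d / w d @[d --> F] --> q -> b d / s d @[d --> F] --> z ->
  x * q = z * p.
Proof.
move=> aw as_ bw bs.
have L1 : (a d / s d) * (b d / w d) @[d --> F] --> x * q by exact: cvgM.
have L2 : (b d / s d) * (a d / w d) @[d --> F] --> z * p by exact: cvgM.
have E : (fun d => (a d / s d) * (b d / w d)) = (fun d => (b d / s d)
  * (a d / w d)).
  by apply/funext => d; rewrite mulrACA [RHS]mulrACA [a d * b d]mulrC.
rewrite E in L1; exact: (cvg_unique (@Rhausdorff R) L1 L2).
Qed.

Lemma completion_within_ge0 (R : realType) (m : nat) (M : queue R m)
    (R0 : nat -> 'rV[R]_m) (xi gam : nat -> nat -> R -> 'rV[R]_m) (d : R) :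
  (0 < qh M)%N ->
  steady_state_densities M R0 xi gam -> 0 <= completion_within M xi gam d.
Proof.
move=> h0 [_ xidens gamdens _]; apply: fine_ge0; apply: adde_ge0;
  apply: nneseries_ge0 => n _ _; rewrite lee_fin mass_sum big_nat_cond;
  apply: sumr_ge0 => k /andP[/andP[k1 k2] _]; apply: mass_ge0 => i;
  apply: vint_ge0 => u /=; rewrite in_itv/= => /andP[u0 _].
- by have [|->//] := xidens n k i; rewrite k1.
- move: k2; rewrite ltnS leq_min => /andP[kn kh].
  by have [||->//] := gamdens n k i; rewrite // (leq_ltn_trans kh) // prednK.
Qed.

Lemma completion_probabilities_ge0 (R : realType) (m : nat) (M : queue R m)
    (R0 : nat -> 'rV[R]_m) (xi gam : nat -> nat -> R -> 'rV[R]_m)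
    (xip gamp : nat -> nat -> 'rV[R]_m) :
  (0 < qh M)%N ->
  steady_state_densities M R0 xi gam ->
  completion_epoch_probabilities M xi gam xip gamp ->
  (forall n r i, (qh M <= r <= qH M)%N -> 0 <= xip n r 0 i) /\
  (forall n k i, (k < qh M)%N -> (k <= n)%N -> 0 <= gamp n k 0 i).
Proof.
move=> h0 dens [xipE gampE _]; have W0 d := completion_within_ge0 d h0 dens.
case: dens => _ xidens gamdens _.
split=> [n r i hr|n k i kh kn].
- apply: cvgr_to_ge (xipE n r i hr) _; apply: nearW => d.
  apply: divr_ge0 => //; apply: vint_ge0 => u /=;
    rewrite in_itv/= => /andP[u0 _].
  exact: (xidens n r i hr).1.
- apply: cvgr_to_ge (gampE n k i kh kn) _; apply: nearW => d.
  apply: divr_ge0 => //; apply: vint_ge0 => u /=;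
    rewrite in_itv/= => /andP[u0 _].
  exact: (gamdens n k i kh kn).1.
Qed.

(** The probability of an epoch with a given mark in ]0, d], divided by d,
    tends to the corresponding density at 0; divided by the probability of any
    epoch, it tends to the conditional probability of the mark.  So the two
    limits are proportional as soon as one conditional probability is nonzero,
    which holds because they sum to 1. *)
Lemma completion_rate (R : realType) (m : nat) (M : queue R m)
    (xibar : 'rV[R]_m) (R0 : nat -> 'rV[R]_m)
    (xi gam : nat -> nat -> R -> 'rV[R]_m) (xip gamp : nat -> nat -> 'rV[R]_m) :
  is_queue M xibar -> steady_state_densities M R0 xi gam ->
  steady_state_equations M R0 xi gam ->
  completion_epoch_probabilities M xi gam xip gamp ->
  exists c : R,
    (forall n r, (qh M <= r <= qH M)%N -> xi n r 0 = c *: xip n r) /\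
    (forall n k, (k < qh M)%N -> (k <= n)%N -> gam n k 0 = c *: gamp n k).
Proof.
move=> hM dens eqs [xipE gampE tot].
have xiE n r i : (qh M <= r <= qH M)%N ->
    ends_within xi d n r 0 i / d @[d --> 0^'+] --> xi n r 0 0 i.
  by move=> hr; exact: (cascade_end_rate (service_cascade hM dens eqs hr)).
have gamE n k i : (k < qh M)%N -> (k <= n)%N ->
    ends_within gam d n k 0 i / d @[d --> 0^'+] --> gam n k 0 0 i.
  move=> kh kn; have := @cascade_end_rate _ _ _ _ _ _ _ (n - k) i
    (vacation_cascade dens eqs kh).
  by rewrite /= subnK.
have [[w [p [x [p0 wp wx]]]]|none] := EM (exists (w : R -> R) (p x : R),
    [/\ p != 0, w d / completion_within M xi gam d @[d --> 0^'+] --> p &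
        w d / d @[d --> 0^'+] --> x]).
- exists (x / p); split=> [n r hr|n k kh kn]; apply/rowP => i; rewrite mxE.
    have E := cross_ratio_limits wp wx (xipE n r i hr) (xiE n r i hr).
    by rewrite mulrAC E mulfK.
  have E := cross_ratio_limits wp wx (gampE n k i kh kn) (gamE n k i kh kn).
  by rewrite mulrAC E mulfK.
(* If every mark had conditional probability 0, their sum would be 0. *)
- suff : (0 = 1 :> \bar R)%E by move=> /eqP; rewrite eqe eq_sym oner_eq0.
  have /andP[h0 _] : (1 <= qh M <= qH M)%N by case: hM.
  rewrite -tot !eseries0 ?adde0// => n _ _; rewrite mass_sum; congr EFin;
    rewrite big_nat_cond big1// => k /andP[/andP[k1 k2] _];
      rewrite massE big1// => i _;
    apply/eqP; apply: contra_notT none => p0.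
  + have kh : (k < qh M)%N.
      by move: k2; rewrite ltnS leq_min => /andP[_ /leq_ltn_trans]; apply;
        rewrite prednK.
    have kn : (k <= n)%N by move: k2; rewrite ltnS leq_min => /andP[].
    exists (fun d => ends_within gam d n k 0 i), (gamp n k 0 i),
      (gam n k 0 0 i).
    by split => //; [exact: gampE|exact: gamE].
  + have hr : (qh M <= k <= qH M)%N by rewrite k1.
    exists (fun d => ends_within xi d n k 0 i), (xip n k 0 i), (xi n k 0 0 i).
    by split => //; [exact: xipE|exact: xiE].
Qed.

(** * Splitting the total probability *)

Lemma cvg_sum_seq (R : realType) (I : eqType) (s : seq I) (f : I -> nat -> R)
    (l : I -> R) :
  (forall i, i \in s -> f i n @[n --> \oo] --> l i) ->
  \sum_(i <- s) f i n @[n --> \oo] --> \sum_(i <- s) l i.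
Proof.
elim: s => [|i s IH] fl.
  by rewrite big_nil; under eq_fun do rewrite big_nil; exact: cvg_cst.
rewrite big_cons; under eq_fun do rewrite big_cons.
apply: cvgD; first by apply: fl; rewrite mem_head.
by apply: IH => j js; apply: fl; rewrite in_cons js orbT.
Qed.

(** If nonnegative terms are summed over two indices, one of them in a finite
    range, convergence of the double sum forces convergence of each inner
    series. *)
Lemma range_series (R : realType) (a : nat -> nat -> R) (m p : nat)
    (total : R) :
  (forall i n, (m <= i < p)%N -> 0 <= a i n) ->
  (\sum_(0 <= k < n) \sum_(m <= i < p) a i k) @[n --> \oo] --> total ->
  exists l : nat -> R,
    (forall i, (m <= i < p)%N -> (\sum_(0 <= k < n) a i k) @[n --> \oo] -->
      l i) /\
    total = \sum_(m <= i < p) l i.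
Proof.
move=> a0 atot.
pose S n := \sum_(0 <= k < n) \sum_(m <= i < p) a i k.
have sumr0 k : 0 <= \sum_(m <= i < p) a i k.
  by rewrite big_nat_cond sumr_ge0// => i; rewrite andbT => /a0.
have ndsum (b : nat -> R) : (forall k, 0 <= b k) ->
    {homo (fun n => \sum_(0 <= k < n) b k) : n1 n2 / (n1 <= n2)%N >-> n1 <= n2}.
  move=> b0 n1 n2 n12; rewrite [leRHS](@big_cat_nat _ _ _ n1)//= lerDl.
  exact: sumr_ge0.
have Sle n : S n <= total.
  have -> : total = limn S by apply/esym/cvg_lim.
  by apply: nondecreasing_cvgn_le; [exact: ndsum|apply/cvg_ex; exists total].
pose l i := limn (fun n => \sum_(0 <= k < n) a i k).
have lP i : (m <= i < p)%N -> (\sum_(0 <= k < n) a i k) @[n --> \oo] --> l i.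
  move=> imp; apply: nondecreasing_is_cvgn;
    first by apply: ndsum => k; exact: a0.
  exists total => _ [n _ <-]; apply: le_trans (Sle n); apply: ler_sum => k _.
  rewrite (bigD1_seq i) ?mem_index_iota ?iota_uniq//= lerDl big_seq_cond.
  by apply: sumr_ge0 => j /andP[]; rewrite mem_index_iota => /a0.
exists l; split => //.
have {}atot : \sum_(m <= i < p) \sum_(0 <= k < n) a i k @[n --> \oo] --> total.
  by under eq_fun do rewrite exchange_big.
have L : \sum_(m <= i < p) (\sum_(0 <= k < n) a i k) @[n --> \oo] -->
    \sum_(m <= i < p) l i.
  by apply: cvg_sum_seq => i; rewrite mem_index_iota => /lP.
exact: (cvg_unique (@Rhausdorff R) atot L).
Qed.

Lemma shifted_series (R : realType) (a : nat -> R) (k : nat) (l : R) :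
  (\sum_(0 <= j < n) (if (k <= j)%N then a j else 0)) @[n --> \oo] --> l ->
  (\sum_(0 <= j < n) a (j + k)%N) @[n --> \oo] --> l.
Proof.
rewrite -(cvg_shiftn k); apply: cvg_trans; apply: near_eq_cvg;
  apply: nearW => n /=.
rewrite (@big_cat_nat _ _ _ k) ?leq_addl//= big_nat_cond big1 =>
  [|j /andP[/andP[_ jk] _]].
  by rewrite add0r -{1}[k]add0n big_addn addnK; apply: eq_bigr => j _;
    rewrite leq_addl.
by rewrite leqNgt jk.
Qed.

(** The extended real total is 1, so neither nonnegative series is infinite. *)
Lemma total_mass_series (R : realType) (m : nat) (M : queue R m)
    (x g : nat -> nat -> 'rV[R]_m) (a : R) :
  (0 < qh M)%N ->
  (forall n r i, (qh M <= r <= qH M)%N -> 0 <= x n r 0 i) ->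
  (forall n k i, (k < qh M)%N -> (k <= n)%N -> 0 <= g n k 0 i) ->
  (a%:E + \sum_(0 <= n <oo) (mass (service_marginal M x n))%:E
   + \sum_(0 <= n <oo) (mass (vacation_marginal M g n))%:E = 1)%E ->
  exists lx lg : R,
    [/\ (\sum_(0 <= k < n) mass (service_marginal M x k)) @[n --> \oo] --> lx,
        (\sum_(0 <= k < n) mass (vacation_marginal M g k)) @[n --> \oo] --> lg &
        a + lx + lg = 1].
Proof.
move=> h0 x0 g0.
have sx0 n : 0 <= mass (service_marginal M x n).
  apply: mass_ge0 => i; rewrite summxE big_nat_cond sumr_ge0// => r;
    rewrite andbT => hr.
  exact: x0.
have sg0 n : 0 <= mass (vacation_marginal M g n).
  apply: mass_ge0 => i; rewrite summxE big_nat_cond sumr_ge0// => k.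
  rewrite andbT /= ltnS leq_min => /andP[kn kh].
  by apply: g0 => //; rewrite (leq_ltn_trans kh) // prednK.
set X := (\sum_(0 <= n <oo) (mass (service_marginal M x n))%:E)%E.
set G := (\sum_(0 <= n <oo) (mass (vacation_marginal M g n))%:E)%E.
have X0 : (0 <= X)%E by apply: nneseries_ge0 => n _ _; rewrite lee_fin.
have G0 : (0 <= G)%E by apply: nneseries_ge0 => n _ _; rewrite lee_fin.
move XE : X X0 => X' X'0; move GE : G G0 => G' G'0.
case: X' X'0 XE => [lx _ XE| |] //; case: G' G'0 GE => [lg _ GE| |] //.
move=> [E]; exists lx, lg; split => //; exact/nneseries_EFin.
Qed.

(** * Start rates of services and the dormant state *)

(** The equations of the dormant state and the integrated cascade equations
    have this form. *)
Lemma generator_solve (R : realType) (m : nat) (C D : 'M[R]_m)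
    (x y : 'rV[R]_m) :
  is_MAP C D -> x *m C = - y -> x = y *m invmx (- C).
Proof.
move=> [_ _ uC _ _] xy; rewrite -[y]opprK -xy -mulmxN mulmxK//.
by rewrite -scaleN1r unitmxZ// unitrN1.
Qed.

Lemma sum_nat_indicator (R : realType) (F : nat -> R) (m p i : nat) :
  (m <= i < p)%N -> \sum_(m <= r < p) (r == i)%:R * F r = F i.
Proof.
move=> imp; rewrite (bigD1_seq i) ?mem_index_iota ?iota_uniq//= eqxx mul1r.
by rewrite big1 ?addr0// => r /negPf ->; rewrite mul0r.
Qed.

Lemma series_supported_at0 (R : realType) (a : R) :
  (\sum_(0 <= k < n) (k == 0%N)%:R * a) @[n --> \oo] --> a.
Proof.
apply: cvg_near_cst; near=> n; apply: (sum_nat_indicator (fun=> a)) => /=.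
by near: n; exists 1%N.
Unshelve. all: by end_near. Qed.

Lemma service_marginalZ (R : realType) (m : nat) (M : queue R m)
    (x y : nat -> nat -> 'rV[R]_m) (c : R) (n : nat) :
  (forall r, (qh M <= r <= qH M)%N -> x n r = c *: y n r) ->
  service_marginal M x n = c *: service_marginal M y n.
Proof.
move=> xy; rewrite /service_marginal scaler_sumr big_nat_cond [RHS]big_nat_cond.
by apply: eq_bigr => r; rewrite andbT ltnS => /xy.
Qed.

Lemma vacation_marginalZ (R : realType) (m : nat) (M : queue R m)
    (x y : nat -> nat -> 'rV[R]_m) (c : R) (n : nat) : (0 < qh M)%N ->
  (forall k, (k < qh M)%N -> (k <= n)%N -> x n k = c *: y n k) ->
  vacation_marginal M x n = c *: vacation_marginal M y n.
Proof.
move=> h0 xy; rewrite /vacation_marginal scaler_sumr big_nat_cond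
  [RHS]big_nat_cond.
apply: eq_bigr => k; rewrite andbT /= ltnS leq_min => /andP[kn kh].
by apply: xy => //; rewrite (leq_ltn_trans kh)// prednK.
Qed.

(** In the dormant state with n customers the phase is fed by arrivals from
    n - 1 customers and by vacations that end with n customers: solving for
    R0 n gives the powers of Dtilde.  In terms of mass, all the vacations that
    end below the threshold eventually pass through h - 1 customers. *)
Lemma dormant_phases (R : realType) (m : nat) (M : queue R m)
    (xibar : 'rV[R]_m) (R0 : nat -> 'rV[R]_m)
    (xi gam : nat -> nat -> R -> 'rV[R]_m) (gp : nat -> 'rV[R]_m) (c : R) :
  is_queue M xibar -> steady_state_equations M R0 xi gam -> ~~ qmv M ->
  (forall n, vacation_marginal M (at_end gam) n = c *: gp n) ->
  (forall n, (n < qh M)%N ->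
     R0 n = c *: \sum_(0 <= j < n.+1) gp j *m Dtilde M ^+ (n - j)
       *m invmx (- qC M)) /\
  mass (R0 (qh M).-1 *m qD M) = c * \sum_(0 <= n < qh M) mass (gp n).
Proof.
move=> [[hMAP _] /andP[h0 hH] _ _ _] [eq0 [eqn _]] SV gpE.
have eps0 : 1 - qeps M = 1 by rewrite /qeps (negbTE SV) subr0.
rewrite eps0 scale1r in eq0.
have {}eq0 : R0 0%N *m qC M = - (c *: gp 0%N).
  apply/eqP; rewrite -addr_eq0 -gpE vacation_marginal_lt// big_nat1;
    exact/eqP/esym.
have {}eqn n : (n.+1 < qh M)%N ->
    R0 n.+1 *m qC M = - (R0 n *m qD M + c *: gp n.+1).
  move=> nh; apply/eqP; rewrite -addr_eq0 -gpE vacation_marginal_lt// addrA.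
  have /eqn : (1 <= n.+1 <= (qh M).-1)%N by rewrite /= -ltnS prednK.
  by rewrite eps0 scale1r => E; apply/eqP/esym.
have solve := generator_solve hMAP.
split.
- elim=> [|n IH] nh.
    by rewrite big_nat1 expr0 mulmx1 scalemxAl; exact: solve.
  rewrite (solve _ _ (eqn n nh)) IH ?(ltnW nh)// mulmxDl.
  rewrite [in RHS]big_nat_recr//= subnn expr0 mulmx1 scalerDr -scalemxAl;
    congr (_ + _); last first.
    by rewrite scalemxAl.
  rewrite -!scalemxAl; congr (_ *: _); rewrite !mulmx_suml;
    apply: eq_big_nat => j /andP[_ jn].
  by rewrite subSn // exprSr /Dtilde !mulmxA.
- have flow n : (n < qh M)%N -> mass (R0 n *m qD M) = c *
      \sum_(0 <= j < n.+1) mass (gp j).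
    elim: n => [|n IH] nh.
      by rewrite big_nat1 -[LHS]opprK -(generator_mass _ hMAP)
        eq0 massN opprK massZ.
    rewrite big_nat_recr//= mulrDr -IH ?(ltnW nh)// -[LHS]opprK
      -(generator_mass _ hMAP).
    by rewrite eqn// massN opprK massD massZ.
  by rewrite flow prednK.
Qed.

(** The range of k in the marginal depends on n; over a fixed range, the two
    sums over n and k can be exchanged. *)
Lemma vacation_marginal_mass (R : realType) (m : nat) (M : queue R m)
    (g : nat -> nat -> 'rV[R]_m) (n : nat) : (0 < qh M)%N ->
  mass (vacation_marginal M g n) =
  \sum_(0 <= k < qh M) (if (k <= n)%N then mass (g n k) else 0).
Proof.
move=> h0; rewrite mass_sum.
have le_h : ((minn n (qh M).-1).+1 <= qh M)%N by
  rewrite -[leqRHS]prednK// ltnS geq_minr.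
rewrite [RHS](big_cat_nat (n := (minn n (qh M).-1).+1))//=.
rewrite [X in _ = _ + X]big_nat_cond [X in _ = _ + X]big1 ?addr0.
  apply: eq_big_nat => k /andP[_]; rewrite ltnS leq_min => /andP[-> _] //.
move=> k /andP[/andP[]]; rewrite gtn_min => /orP[|] kn kh _.
  by rewrite leqNgt kn.
by move: kh; rewrite -(prednK h0) ltnS leqNgt kn.
Qed.

Lemma completions_scaled (R : realType) (m : nat) (M : queue R m)
    (xi gam : nat -> nat -> R -> 'rV[R]_m) (xip gamp : nat -> nat -> 'rV[R]_m)
    (c : R) :
  (0 < qh M)%N ->
  (forall n r, (qh M <= r <= qH M)%N -> xi n r 0 = c *: xip n r) ->
  (forall n k, (k < qh M)%N -> (k <= n)%N -> gam n k 0 = c *: gamp n k) ->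
  (forall n, service_marginal M (at_end xi) n =
     c *: service_marginal M xip n) /\
  (forall n, vacation_marginal M (at_end gam) n =
     c *: vacation_marginal M gamp n).
Proof.
move=> h0 hxi hgam; split=> n;
  first by apply: service_marginalZ => r; exact: hxi.
by apply: vacation_marginalZ => // k; exact: hgam.
Qed.

Lemma long_queue_completions (R : realType) (m : nat) (M : queue R m)
    (xip gamp : nat -> nat -> 'rV[R]_m) (u : nat -> R) :
  (0 < qh M)%N ->
  (forall n r i, (qh M <= r <= qH M)%N -> 0 <= xip n r 0 i) ->
  (forall n k i, (k < qh M)%N -> (k <= n)%N -> 0 <= gamp n k 0 i) ->
  (\sum_(0 <= n <oo) (mass (service_marginal M xip n))%:E
   + \sum_(0 <= n <oo) (mass (vacation_marginal M gamp n))%:E = 1)%E ->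
  (forall n, u n =
    mass (service_marginal M xip n + vacation_marginal M gamp n)) ->
  forall N, (\sum_(N <= k < n) u k) @[n --> \oo] -->
    fine (\sum_(N <= n <oo) (u n)%:E)%E.
Proof.
move=> h0 xip0 gamp0 tot uE N.
have [|lx [lg [xcvg gcvg _]]] := @total_mass_series _ _ M xip gamp 0 h0 xip0
  gamp0.
  by rewrite add0e.
have u0 n : 0 <= u n.
  rewrite uE massD addr_ge0 ?mass_ge0// => i;
    rewrite summxE big_nat_cond sumr_ge0// => k.
    by rewrite andbT => hk; exact: xip0.
  rewrite andbT /= ltnS leq_min => /andP[kn kh].
  by apply: gamp0 => //; rewrite (leq_ltn_trans kh) // prednK.
have ucvg : (\sum_(0 <= k < n) u k) @[n --> \oo] --> lx + lg.
  under eq_fun do under eq_bigr do rewrite uE massD.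
  under eq_fun do rewrite big_split/=.
  exact: cvgD.
suff L : (\sum_(N <= k < n) u k) @[n --> \oo] --> lx + lg -
    \sum_(0 <= k < N) u k.
  by rewrite ((nneseries_EFin _ N u0).2 L).
have L : \sum_(0 <= k < n) u k - \sum_(0 <= k < N) u k @[n --> \oo] -->
    lx + lg - \sum_(0 <= k < N) u k.
  by apply: cvgB => //; exact: cvg_cst.
apply: cvg_trans L; apply: near_eq_cvg; near=> n.
rewrite (@big_cat_nat _ _ _ N 0 n)//=; last by near: n; exists N.
by rewrite addrAC subrr add0r.
Unshelve. all: by end_near. Qed.

(** For r < H only level 0 is fed, by completions that leave r customers and,
    if r = h, by the dormant state; for r = H also all the longer queues
    contribute, which is the term T. *)
Lemma service_start_rate (R : realType) (m : nat) (M : queue R m)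
    (R0 : nat -> 'rV[R]_m) (xi gam : nat -> nat -> R -> 'rV[R]_m)
    (u : nat -> R) (c T : R) (r : nat) :
  (0 < qh M <= r)%N ->
  (forall n, mass (completions M xi gam n) = c * u n) ->
  (\sum_((qH M).+1 <= k < n) u k) @[n --> \oo] --> T ->
  (\sum_(0 <= k < n) mass (service_starts M R0 xi gam r k)) @[n --> \oo] -->
    (r == qh M)%:R * ((1 - qeps M) * mass (R0 (qh M).-1 *m qD M)) + c * u r
    + (r == qH M)%:R * (c * T).
Proof.
move=> /andP[h0 hr] compE uT.
(* Shifted by H, the truncation v vanishes at 0, so level 0 can be treated
   alike for all r. *)
pose v j := if (qH M < j)%N then u j else 0.
have vT : (\sum_(0 <= k < n) v (k + qH M)%N) @[n --> \oo] --> T.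
  apply: shifted_series; rewrite -(cvg_shiftn (qH M).+1) in uT;
    rewrite -(cvg_shiftn (qH M).+1).
  apply: cvg_trans uT; apply: near_eq_cvg; apply: nearW => n /=.
  rewrite [RHS](@big_cat_nat _ _ _ (qH M).+1) ?leq_addl//=.
  rewrite [X in _ = X + _]big_nat_cond [X in _ = X + _]big1 ?add0r.
    by apply: eq_big_nat => j /andP[Hj _]; rewrite /v Hj (ltnW Hj).
  by move=> j /andP[/andP[_ jH] _];
    rewrite /v (_ : (qH M < j)%N = false) ?if_same// ltnNge -ltnS jH.
have startE k : mass (service_starts M R0 xi gam r k) =
    (k == 0%N)%:R * ((r == qh M)%:R * ((1 - qeps M)
      * mass (R0 (qh M).-1 *m qD M)) + c * u r)
    + (r == qH M)%:R * (c * v (k + qH M)%N).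
  rewrite /service_starts /v; case: k => [|k] /=.
    rewrite add0n ltnn !mulr0 addr0 mul1r massD compE; congr (_ + _).
    by case: eqVneq => _; rewrite ?massZ ?mul1r// mass0 mul0r.
  case: (r =P qH M) => [->|_]; last by rewrite mass0 !mul0r addr0.
  by rewrite add0r compE mul0r add0r mul1r addSn ltnS leq_addl.
under eq_fun do under eq_bigr do rewrite startE.
under eq_fun do rewrite big_split/= -!mulr_sumr.
apply: cvgD; first exact: series_supported_at0.
by apply: cvgM; [exact: cvg_cst|]; apply: cvgM; [exact: cvg_cst|].
Qed.

(** * The normalizing constant *)

Lemma service_load (R : realType) (m : nat) (M : queue R m)
    (xibar : 'rV[R]_m) (R0 : nat -> 'rV[R]_m)
    (xi gam : nat -> nat -> R -> 'rV[R]_m) (u : nat -> R) (c T l : R)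
    (r : nat) :
  is_queue M xibar -> steady_state_densities M R0 xi gam ->
  steady_state_equations M R0 xi gam -> (qh M <= r <= qH M)%N ->
  (forall n, mass (completions M xi gam n) = c * u n) ->
  (\sum_((qH M).+1 <= k < n) u k) @[n --> \oo] --> T ->
  (\sum_(0 <= k < n) mass (arb xi k r)) @[n --> \oo] --> l ->
  l = ((r == qh M)%:R * ((1 - qeps M) * mass (R0 (qh M).-1 *m qD M)) + c * u r
       + (r == qH M)%:R * (c * T)) * mean (qs M r).
Proof.
move=> hM dens eqs hr compE uT lE.
have cas := service_cascade hM dens eqs hr.
have [[hMAP _] /andP[h0 _] hs _ _] := hM; have [ds ms] := hs r hr.
apply: (cascade_total_mass hMAP ds ms cas lE).
by apply: service_start_rate => //; rewrite h0; case/andP: hr.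
Qed.

Lemma vacation_load (R : realType) (m : nat) (M : queue R m)
    (xibar : 'rV[R]_m) (R0 : nat -> 'rV[R]_m)
    (xi gam : nat -> nat -> R -> 'rV[R]_m) (l : R) (k : nat) :
  is_queue M xibar -> steady_state_densities M R0 xi gam ->
  steady_state_equations M R0 xi gam -> (k < qh M)%N ->
  (\sum_(0 <= j < n) mass (arb gam (j + k)%N k)) @[n --> \oo] --> l ->
  l = mass (vacation_starts M xi gam k 0) * mean (qv M k).
Proof.
move=> hM dens eqs kh lE.
have cas := vacation_cascade dens eqs kh.
have [[hMAP _] _ _ hv _] := hM; have [dv mv] := hv k kh.
apply: (cascade_total_mass hMAP dv mv cas lE).
have E j : mass (vacation_starts M xi gam k j) =
    (j == 0%N)%:R * mass (vacation_starts M xi gam k 0).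
  by case: j => [|j]; rewrite ?mul1r// /vacation_starts /= mass0 mul0r.
under eq_fun do under eq_bigr do rewrite E.
exact: series_supported_at0.
Qed.

(** Total probability: with c the rate of completions, each term of the
    normalization condition is c times the corresponding term of E.  The services
    of size h started out of the dormant state are as many as the vacations
    that end below the threshold, whence the term with the mean of size h in
    the sum over n < h. *)
Lemma completion_rate_normalization (R : realType) (m : nat) (M : queue R m)
    (xibar : 'rV[R]_m) (R0 : nat -> 'rV[R]_m)
    (xi gam : nat -> nat -> R -> 'rV[R]_m) (xip gamp : nat -> nat -> 'rV[R]_m)
    (c : R) :
  is_queue M xibar -> steady_state_densities M R0 xi gam ->
  steady_state_equations M R0 xi gam ->
  completion_epoch_probabilities M xi gam xip gamp ->
  (forall n r, (qh M <= r <= qH M)%N -> xi n r 0 = c *: xip n r) ->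
  (forall n k, (k < qh M)%N -> (k <= n)%N -> gam n k 0 = c *: gamp n k) ->
  c * E_const M xip gamp = 1.
Proof.
move=> hM dens eqs hplus hxi hgam.
have [_ /andP[h0 hH] _ _ _] := hM.
have [xip0 gamp0] := completion_probabilities_ge0 h0 dens hplus.
have [xpE gpE] := completions_scaled h0 hxi hgam.
set xp := service_marginal M xip in xpE *;
  set gp := vacation_marginal M gamp in gpE *.
pose u n := mass (xp n + gp n).
have compE n : mass (completions M xi gam n) = c * u n.
  by rewrite /completions xpE gpE -scalerDr massZ.
set T := fine (\sum_((qH M).+1 <= n <oo) (u n)%:E)%E.
have uT : (\sum_((qH M).+1 <= k < n) u k) @[n --> \oo] --> T.
  by case: hplus => _ _ tot; exact: (long_queue_completions h0 xip0 gamp0 tot).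
have [_ xidens gamdens tot] := dens.
have axi0 n r i : (qh M <= r <= qH M)%N -> 0 <= arb xi n r 0 i.
  move=> hr; apply: vint_ge0 => v; rewrite /halfline/= in_itv/= andbT => v0.
  exact: (xidens n r i hr).1.
have agam0 n k i : (k < qh M)%N -> (k <= n)%N -> 0 <= arb gam n k 0 i.
  move=> kh kn; apply: vint_ge0 => v; rewrite /halfline/= in_itv/= andbT => v0.
  exact: (gamdens n k i kh kn).1.
have [lx [lg [xcvg gcvg total]]] := total_mass_series h0 axi0 agam0 tot.
have [||ls [lsE lxE]] := @range_series R (fun r k => mass (arb xi k r)) (qh M)
  (qH M).+1 lx.
- by move=> r n hr; apply: mass_ge0 => i; exact: axi0.
- by under eq_fun do under eq_bigr do rewrite -mass_sum; exact: xcvg.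
have [||lv [lvE lgE]] := @range_series R
    (fun k n => if (k <= n)%N then mass (arb gam n k) else 0) 0 (qh M) lg.
- by move=> k n kh; case: ifP => // kn; apply: mass_ge0 => i; exact: agam0.
- by under eq_fun do under eq_bigr do rewrite -vacation_marginal_mass//;
    exact: gcvg.
have dormant : (1 - qeps M) * mass (R0 (qh M).-1 *m qD M) =
      (1 - qeps M) * (c * \sum_(0 <= n < qh M) mass (gp n)) /\
    (1 - qeps M) * \sum_(0 <= n < qh M) mass (R0 n) =
      (1 - qeps M) * (c * \sum_(0 <= n < qh M) \sum_(0 <= j < n.+1)
        mass (gp j *m Dtilde M ^+ (n - j) *m invmx (- qC M))).
  case: (boolP (qmv M)) => [MV|SV]; first by rewrite /qeps MV subrr !mul0r.
  have [R0E ->] := dormant_phases hM eqs SV gpE; split=> //; congr (_ * _).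
  rewrite mulr_sumr; apply: eq_big_nat => n /andP[_ nh].
  by rewrite R0E// massZ mass_sum.
(* The start out of the dormant state and the long queues concern r = h and
   r = H only, so they are written as sums over r with an indicator; this also
   covers h = H. *)
have lxV : lx = (1 - qeps M) * mass (R0 (qh M).-1 *m qD M) * mean (qs M (qh M))
    + c * (\sum_(qh M <= r < (qH M).+1) u r * mean (qs M r))
    + c * (mean (qs M (qH M)) * T).
  rewrite lxE mulr_sumr -[in RHS](@sum_nat_indicator _
    (fun r => (1 - qeps M) * mass (R0 (qh M).-1 *m qD M) * mean (qs M r))
    (qh M) (qH M).+1 (qh M)); last by rewrite leqnn.
  rewrite -[X in _ = _ + X](@sum_nat_indicator _
    (fun r => c * (mean (qs M r) * T)) (qh M) (qH M).+1 (qH M));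
      last by rewrite hH/=.
  rewrite -!big_split/=; apply: eq_big_nat => r hr.
  by rewrite (service_load hM dens eqs hr compE uT (lsE r hr)); ring.
have lgV : lg = c * \sum_(0 <= k < qh M)
    (mass (xp k) + qeps M * mass (gp k)) * mean (qv M k).
  rewrite lgE mulr_sumr; apply: eq_big_nat => k kh.
  rewrite (vacation_load hM dens eqs kh (shifted_series (lvE k kh))).
  by rewrite /vacation_starts /= xpE gpE massD !massZ; ring.
have idleV : \sum_(0 <= n < qh M) (mass (xp n) * mean (qv M n)
      + (1 - qeps M) * mass (gp n) * mean (qs M (qh M)) + qeps M * mass (gp n)
        * mean (qv M n)) =
    \sum_(0 <= k < qh M) (mass (xp k) + qeps M * mass (gp k)) * mean (qv M k)
    + (1 - qeps M) * (\sum_(0 <= n < qh M) mass (gp n)) * mean (qs M (qh M)).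
  rewrite mulr_sumr mulr_suml -big_split/=; apply: eq_bigr => n _; ring.
rewrite -total dormant.2 lxV dormant.1 lgV /E_const /w_hat -/xp -/gp -/T idleV.
ring.
Qed.

(** * Arbitrary-epoch probabilities *)

(** The equation of level n integrated over all remaining times; the boundary
    term y n 0 appears because the density vanishes at infinity. *)
Lemma cascade_arbitrary_epoch (R : realType) (m : nat) (C D : 'M[R]_m)
    (f : R -> R) (B : nat -> 'rV[R]_m) (y : nat -> R -> 'rV[R]_m) (n : nat) :
  is_MAP C D -> is_density f -> cascade C D f B y ->
  vint (halfline R) (y n) =
  ((if n is p.+1 then vint (halfline R) (y p) else 0) *m D + B n - y n 0)
    *m invmx (- C).
Proof.
move=> hMAP df cy; apply: (generator_solve hMAP).
have f1 : \int[@lebesgue_measure R]_(v in `[0, +oo[) f v = 1.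
  by have [_ _ f1] := df; rewrite /Rintegral f1.
have yE := cascade_ray n df cy (lexx 0);
  rewrite f1 scale1r -/(halfline R) in yE.
by rewrite opprB {1}yE -[X in X - _]addrA addrK.
Qed.

Theorem theorem6 (R : realType) (m : nat) (M : queue R m) (xibar : 'rV[R]_m)
    (R0 : nat -> 'rV[R]_m) (xi gam : nat -> nat -> R -> 'rV[R]_m)
    (xip gamp : nat -> nat -> 'rV[R]_m)
    (hM : is_queue M xibar)
    (hdens : steady_state_densities M R0 xi gam)
    (heqs : steady_state_equations M R0 xi gam)
    (hplus : completion_epoch_probabilities M xi gam xip gamp) :
  let D := qD M in
  let Ci := invmx (- qC M) in
  let h := qh M in
  let H := qH M in
  let eps := qeps M in
  let E := E_const M xip gamp in
  let xp := service_marginal M xip in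
  let gp := vacation_marginal M gamp in
  E != 0 /\
  (~~ qmv M -> forall n, (n < h)%N ->
     R0 n = E^-1 *: \sum_(0 <= j < n.+1) gp j *m Dtilde M ^+ (n - j) *m Ci) /\
  arb xi 0%N h =
    ((1 - eps) *: (R0 h.-1 *m D) + E^-1 *: (xp h + gp h - xip 0%N h)) *m Ci /\
  (forall r, (h.+1 <= r < H)%N ->
     arb xi 0%N r = (E^-1 *: (xp r + gp r - xip 0%N r)) *m Ci) /\
  (forall n r, (1 <= n)%N -> (h <= r < H)%N ->
     arb xi n r = (arb xi n.-1 r *m D - E^-1 *: xip n r) *m Ci) /\
  (forall n, (0 < n)%N || (h < H)%N ->
     arb xi n H =
       ((if n is n'.+1 then arb xi n' H else 0) *m D
        + E^-1 *: (xp (n + H)%N + gp (n + H)%N - xip n H)) *m Ci) /\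
  (forall k, (k < h)%N ->
     arb gam k k = (E^-1 *: (xp k + eps *: gp k - gamp k k)) *m Ci) /\
  (forall n k, (k < h)%N -> (k.+1 <= n)%N ->
     arb gam n k = (arb gam n.-1 k *m D - E^-1 *: gamp n k) *m Ci).
Proof.
move=> D Ci h H eps E xp gp.
have [[hMAP _] /andP[h0 hH] hs hv _] := hM.
have [c [hxi hgam]] := completion_rate hM hdens heqs hplus.
have cE : c * E = 1 := completion_rate_normalization hM hdens heqs hplus hxi
  hgam.
have E0 : E != 0.
  by apply: contraTneq (oner_neq0 R) => E0; rewrite -cE E0 mulr0 negbK eqxx.
have Ec : E^-1 = c by rewrite -[E^-1]mul1r -cE mulfK.
have [xpE gpE] := completions_scaled h0 hxi hgam.
have compE n : completions M xi gam n = E^-1 *: (xp n + gp n).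
  by rewrite /completions xpE gpE -scalerDr Ec.
have {}hxi n r : (h <= r <= H)%N -> xi n r 0 = E^-1 *: xip n r by rewrite Ec;
  exact: hxi.
have {}hgam n k : (k < h)%N -> (k <= n)%N -> gam n k 0 = E^-1 *: gamp n k.
  by rewrite Ec; exact: hgam.
have arb_xi n r (hr : (h <= r <= H)%N) :=
  cascade_arbitrary_epoch n hMAP (hs r hr).1 (service_cascade hM hdens heqs hr).
have arb_gam n k (kh : (k < h)%N) :=
  cascade_arbitrary_epoch n hMAP (hv k kh).1 (vacation_cascade hdens heqs kh).
split => //; split; [|split; [|split; [|split; [|split; [|split]]]]].
- by move=> SV n nh; rewrite (dormant_phases hM heqs SV gpE).1// Ec.
- rewrite /arb arb_xi ?leqnn// mul0mx add0r hxi ?leqnn//.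
  by rewrite /service_starts /= eqxx add0n compE -addrA -scalerBr.
- move=> r /andP[hr rH]; have hrH : (h <= r <= H)%N by rewrite (ltnW hr)
    (ltnW rH).
  rewrite /arb arb_xi// mul0mx add0r hxi//.
  by rewrite /service_starts /= gtn_eqF// add0r add0n compE -scalerBr.
- move=> [//|n] r _ /andP[hr rH]; have hrH : (h <= r <= H)%N by rewrite hr ltnW.
  rewrite /arb arb_xi// hxi//.
  by rewrite /service_starts /= ltn_eqF// addr0.
- move=> n hn; rewrite /arb arb_xi ?hH ?leqnn// hxi ?hH ?leqnn//.
  rewrite /service_starts eqxx orbT ifF ?add0r; last first.
    by case: n hn => [|n] //= hn; rewrite gtn_eqF.
  by rewrite compE -addrA -scalerBr; case: n {hn}.
- move=> k kh; have := arb_gam 0%N k kh; rewrite /arb add0n => ->.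
  rewrite mul0mx add0r hgam// /vacation_starts /= xpE gpE -Ec.
  by rewrite (scalerA (qeps M)) [qeps M * _]mulrC -scalerA -scalerDr -scalerBr.
- move=> n k kh kn.
  have -> : n = ((n - k.+1).+1 + k)%N by rewrite addSnnS subnK.
  have := arb_gam (n - k.+1).+1 k kh; rewrite /arb => ->.
  rewrite hgam ?leq_addl// /vacation_starts /= addr0.
  by [].
Qed.
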